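(* Let $$w(x)=\sup_{\tau}\limsup_{T\to\infty}\mathbb E^x\Big\{\int_0^{\tau\wedge T}f(X_s)\,ds+g(X_{\tau\wedge T})\Big\}.$$ Assume (B1): for every $x\in E$ there is $d(x)<0$ such that $$\gamma(x)=\sup_\tau\limsup_{T\to\infty}\mathbb E^x\Big\{\int_0^{\tau\wedge T}\big(f(X_s)-d(x)\big)\,ds\Big\}<\infty.$$ Then $\tau^*=\inf\{t\ge0: g(X_t)\ge w(X_t)\}$ is an optimal stopping time for $w(x)$ for every $x$, and $\mathbb E^x\{\tau^*\}\le M(x):=\dfrac{\gamma(x)+2\|g\|+1}{-d(x)}$.
   Context: $E$ is a locally compact separable metric space in which every closed ball is compact. $(X_t)_{t\ge0}$ is a right-continuous time-homogeneous (standard) Markov process on $E$ with laws $\mathbb P^x$, expectations $\mathbb E^x$, transition probabilities $P_t(x,\cdot)$ and semigroup $P_t\phi(x)=\mathbb E^x\{\phi(X_t)\}$. Standing assumptions: (weak Feller) $P_t\mathcal C_0\subseteq\mathcal C_0$, $\mathcal C_0$ the continuous bounded functions vanishing at infinity; (ergodicity) there is a unique probability measure $\mu$ with $\|P_t(x,\cdot)-\mu\|_{TV}\to0$ for all $x$; $f,g:E\to\mathbb R$ continuous and bounded. $\|\cdot\|$ is the sup norm. Stopping times are with respect to the filtration of $X$ and may be infinite; $\tau$ is optimal if the expression inside the supremum equals $w(x)$. *)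

(* Defs.v *)
From HB Require Import structures.
From mathcomp Require Import all_boot all_order all_algebra.
From mathcomp Require Import all_classical all_reals all_analysis measurable_realfun.
Set Implicit Arguments. Unset Strict Implicit. Unset Printing Implicit Defensive.
Import Order.TTheory GRing.Theory Num.Theory.
Import numFieldNormedType.Exports.
Local Open Scope classical_set_scope.
Local Open Scope ring_scope.

(* metric spaces with a distinguished point (i.e. nonempty); the point is only
   needed so that the Borel sigma-algebra gets MathComp's measurableType instance *)
#[short(type="pmetricType")]
HB.structure Definition PMetric (K : numDomainType) := { M of Metric K M & isPointed M }.

Section Setting.
Context {R : realType}.

Notation borelType E := (g_sigma_algebraType (@open E)).

Definition closed_dball (E : metricType R) (x : E) (r : R) : set E :=
  [set y | mdist x y <= r].

Definition nice_space (E : metricType R) : Prop :=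
  locally_compact [set: E] /\
  (exists D : set E, countable D /\ closure D = [set: E]) /\
  (forall (x : E) (r : R), compact (closed_dball x r)).

Definition C0 (E : metricType R) (phi : E -> R) : Prop :=
  continuous phi /\ (exists C : R, forall x, `|phi x| <= C) /\
  (forall e : R, 0 < e -> exists K : set E, compact K /\
      forall x, ~ K x -> `|phi x| < e).

Definition supnorm (E : metricType R) (phi : E -> R) : \bar R :=
  ereal_sup [set (`|phi x|)%:E | x in [set: E]].

Context {E : pmetricType R} {dO : measure_display} {Omega : measurableType dO}.

Definition filtration (F : R -> set (set Omega)) : Prop :=
  (forall t, 0 <= t -> sigma_algebra [set: Omega] (F t)) /\
  (forall t, 0 <= t -> F t `<=` measurable) /\
  (forall s t, 0 <= s -> s <= t -> F s `<=` F t).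

Definition stopping_time (F : R -> set (set Omega)) (tau : Omega -> \bar R) : Prop :=
  (forall w, (0 <= tau w)%E) /\
  (forall t, 0 <= t -> F t [set w | (tau w <= t%:E)%E]).

Definition F_at (F : R -> set (set Omega)) (tau : Omega -> \bar R) : set (set Omega) :=
  [set A | measurable A /\
     forall t, 0 <= t -> F t (A `&` [set w | (tau w <= t%:E)%E])].

Definition X_at (X : R -> Omega -> E) (tau : Omega -> \bar R) (w : Omega) : E :=
  X (fine (tau w)) w.

Definition stop_min (tau : Omega -> \bar R) (T : R) (w : Omega) : R :=
  fine (Order.min (tau w) T%:E).

Definition Pmix (P : E -> probability Omega R) (mu : probability (borelType E) R)
  (N : set Omega) : \bar R :=
  (\int[mu]_y (P y N))%E.

Definition standard_markov (P : E -> probability Omega R) (X : R -> Omega -> E)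
    (F : R -> set (set Omega)) : Prop :=
  filtration F /\
  (forall t, 0 <= t -> forall A, (forall s, t < s -> F s A) -> F t A) /\
  (* augmented filtration (usual augmentation w.r.t. all P^mu) *)
  (forall t, 0 <= t -> forall A : set Omega,
     (forall mu : probability (borelType E) R, exists B N : set Omega,
        F t B /\ measurable N /\
        measurable_fun [set: borelType E] (fun y : borelType E => P y N) /\
        Pmix P mu N = 0%E /\ (A `\` B) `|` (B `\` A) `<=` N) ->
     F t A) /\
  (forall t, 0 <= t -> forall B : set (borelType E), measurable B ->
     F t (X t @^-1` B)) /\
  (forall x : E, P x [set w | X 0 w = x] = 1%E) /\
  (forall w t, 0 <= t -> (fun s => X s w) @ at_right t --> X t w) /\
  (forall w t, 0 < t -> exists l : E, (fun s => X s w) @ at_left t --> l) /\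
  (forall s, 0 <= s -> forall B : set (borelType E), measurable B ->
     measurable_fun [set: borelType E] (fun y : borelType E => P y (X s @^-1` B))) /\
  (* strong Markov property (contains the simple Markov property, tau = t) *)
  (forall (x : E) (tau : Omega -> \bar R) (s : R), stopping_time F tau -> 0 <= s ->
     forall (A : set Omega) (B : set (borelType E)), F_at F tau A ->
     A `<=` [set w | (tau w < +oo)%E] -> measurable B ->
     P x (A `&` [set w | B (X (fine (tau w) + s) w)]) =
     (\int[P x]_(w in A) P (X_at X tau w) (X s @^-1` B))%E) /\
  (forall (x : E) (taus : nat -> Omega -> \bar R) (tau : Omega -> \bar R),
     (forall n, stopping_time F (taus n)) -> stopping_time F tau ->
     (forall w n, (taus n w <= taus n.+1 w)%E) ->
     (forall w, (fun n => taus n w) @ \oo --> tau w) ->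
     exists N : set Omega, measurable N /\ P x N = 0%E /\
       forall w, ~ N w -> (tau w < +oo)%E ->
         (fun n => X_at X (taus n) w) @ \oo --> X_at X tau w).

Definition semigroup (P : E -> probability Omega R) (X : R -> Omega -> E)
  (t : R) (phi : E -> R) (x : E) : R :=
  fine (\int[P x]_w (phi (X t w))%:E)%E.

Definition weak_feller (P : E -> probability Omega R) (X : R -> Omega -> E) : Prop :=
  forall t, 0 <= t -> forall phi, C0 phi -> C0 (semigroup P X t phi).

Definition tv_limit (P : E -> probability Omega R) (X : R -> Omega -> E)
  (mu : probability (borelType E) R) : Prop :=
  forall (x : E) (eps : R), 0 < eps -> exists T0 : R, forall t, T0 <= t ->
    forall B : set (borelType E), measurable B ->
      (`| P x (X t @^-1` B) - mu B | <= eps%:E)%E.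

Definition ergodic (P : E -> probability Omega R) (X : R -> Omega -> E) : Prop :=
  exists mu : probability (borelType E) R, tv_limit P X mu /\
    forall nu : probability (borelType E) R, tv_limit P X nu ->
      forall B : set (borelType E), measurable B -> nu B = mu B.

Definition payoff (P : E -> probability Omega R) (X : R -> Omega -> E)
  (f g : E -> R) (x : E) (tau : Omega -> \bar R) (T : R) : \bar R :=
  (\int[P x]_w
     ((\int[@lebesgue_measure R]_(s in `[0%R, stop_min tau T w]) (f (X s w))%:E)
      + (g (X (stop_min tau T w) w))%:E))%E.

Definition lim_payoff P X f g x tau : \bar R :=
  limf_esup (fun T : R => payoff P X f g x tau T) (pinfty_nbhs R).

Definition value (P : E -> probability Omega R) (X : R -> Omega -> E)
  (F : R -> set (set Omega)) (f g : E -> R) (x : E) : \bar R :=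
  ereal_sup [set lim_payoff P X f g x tau | tau in stopping_time F].

Definition gamma_fun (P : E -> probability Omega R) (X : R -> Omega -> E)
  (F : R -> set (set Omega)) (f d : E -> R) (x : E) : \bar R :=
  ereal_sup [set limf_esup (fun T : R =>
      (\int[P x]_w
         (\int[@lebesgue_measure R]_(s in `[0%R, stop_min tau T w])
            (f (X s w) - d x)%:E))%E) (pinfty_nbhs R)
    | tau in stopping_time F].

(* tau* = inf { t >= 0 : g(X_t) >= w(X_t) }  (inf of the empty set = +oo) *)
Definition tau_star (X : R -> Omega -> E) (g : E -> R) (w : E -> \bar R)
  (om : Omega) : \bar R :=
  ereal_inf [set t%:E | t in [set t : R | 0 <= t /\ ((g (X t om))%:E >= w (X t om))%E]].

End Setting.

(* Main.v *)
(* The time axis is discretised with mesh 2^-n: backward induction gives functions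
   u_n, the values of the problem in which one stops at grid times up to n, and the
   weak Feller property makes them continuous. They increase to w, so w is lower
   semicontinuous. Let G_n be the open set {u_n < g + 1/(n+1)} and rho_n the entrance
   time of G_n capped at n. These times increase to a limit tau, and quasi-left-continuity
   gives u_j <= g at X_tau for every j, hence tau = tau* almost surely for every starting
   point; the augmentation of the filtration then makes tau* a stopping time.
   An optimal rule s_n on the grid of mesh 2^-2n with horizon 2n cannot stop before
   rho_n, because it only stops where u_n <= g or after time n. By (B1), E s_n is bounded
   by M(x), so E tau <= M(x) by monotone convergence. Finally s_n may be replaced by
   the minimum of s_n and tau, since w <= g at X_tau, and this minimum converges to tau together
   with the state: either rho_n reaches tau after finitely many steps, or the
   path has no jump at tau. *)
Require Import Defs.
From HB Require Import structures.
From mathcomp Require Import all_boot all_order all_algebra.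
From mathcomp Require Import all_classical all_reals all_analysis measurable_realfun.
From mathcomp Require Import ring lra zify.
Set Implicit Arguments. Unset Strict Implicit. Unset Printing Implicit Defensive.
Import Order.TTheory GRing.Theory Num.Theory.
Import numFieldNormedType.Exports.
Local Open Scope classical_set_scope.
Local Open Scope ring_scope.

(** * Bounded measurable functions, right-continuous paths, time integrals *)

(** The contact set {w <= g} is the intersection of the sets {u_n <= g}, hence closed, and its
    entrance time is not visibly a stopping time. Entrance times of open sets are, because paths and
    filtration are right-continuous; this is why the sets G_n carry the slack 1/(n+1), which
    disappears in the limit.

    Expectation and time integral are never exchanged by Fubini. The running reward is a limit of
    Riemann sums, so the strong Markov property is only applied at fixed increments after a stopping
    time, followed by dominated convergence.

    The weak Feller property concerns C0, while the u_n are merely bounded and continuous; cutoffs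
    and a local tightness estimate carry it over.

    The numerator gamma + 2||g|| arises as follows: s_n does at least as well as stopping at once,
    so the expected integral of f up to s_n is at least -2||g||, and (B1) then bounds -d(x) E s_n.
    Finiteness of E tau is also what gives optimality: if C and D bound |f| and |g|, the integrable
    variable C tau + 2D dominates the difference between the payoff of tau* capped at n and that of
    the minimum of s_n and tau. *)

Definition bmeas {R : realType} {d} {T : measurableType d} (D : set T) (Y : T -> R) : Prop :=
  measurable_fun D Y /\ exists C : R, forall w, D w -> `|Y w| <= C.

Section BoundedMeasurable.
Context {R : realType} {d} {T : measurableType d} (D : set T).
Implicit Types Y Z : T -> R.

Lemma bmeas_cst (c : R) : bmeas D (fun _ : T => c).
Proof. by split; [exact: measurable_cst | exists `|c|]. Qed.

Lemma bmeasD Y Z : bmeas D Y -> bmeas D Z -> bmeas D (fun w => Y w + Z w).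
Proof.
move=> [mY [C hC]] [mZ [C' hC']]; split; first exact: measurable_funD.
by exists (C + C') => w Dw; rewrite (le_trans (ler_normD _ _)) ?lerD ?hC ?hC'.
Qed.

Lemma bmeasM Y Z : bmeas D Y -> bmeas D Z -> bmeas D (fun w => Y w * Z w).
Proof.
move=> [mY [C hC]] [mZ [C' hC']]; split; first exact: measurable_funM.
by exists (C * C') => w Dw; rewrite normrM ler_pM ?hC ?hC'.
Qed.

Lemma bmeasB Y Z : bmeas D Y -> bmeas D Z -> bmeas D (fun w => Y w - Z w).
Proof.
move=> [mY [C hC]] [mZ [C' hC']]; split; first exact: measurable_funB.
by exists (C + C') => w Dw; rewrite (le_trans (ler_normB _ _)) ?lerD ?hC ?hC'.
Qed.

Lemma bmeasZ (c : R) Y : bmeas D Y -> bmeas D (fun w => c * Y w).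
Proof. by move=> bY; apply: bmeasM => //; exact: bmeas_cst. Qed.

Lemma bmeas_sum (s : seq nat) (Y : nat -> T -> R) :
  (forall i, bmeas D (Y i)) -> bmeas D (fun w => \sum_(i <- s) Y i w).
Proof.
move=> bY; elim: s => [|i s IH].
  rewrite (_ : (fun w => _) = fun _ => 0); first exact: bmeas_cst.
  by apply/funext => w; rewrite big_nil.
rewrite (_ : (fun w => _) = fun w => Y i w + \sum_(j <- s) Y j w); first exact: bmeasD.
by apply/funext => w; rewrite big_cons.
Qed.

Lemma bmeas_indic (A : set T) : measurable A -> bmeas D (\1_A : T -> R).
Proof.
move=> mA; split; first exact: measurable_indic.
by exists 1 => w _; rewrite indicE; case: (w \in A); rewrite ?normr1 ?normr0.
Qed.

Variable mu : {measure set T -> \bar R}.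
Hypotheses (mD : measurable D) (muD : (mu D < +oo)%E).

Lemma bmeas_integrable Y : bmeas D Y -> mu.-integrable D (EFin \o Y).
Proof.
move=> [mY [C hC]]; apply: measurable_bounded_integrable => //.
exists C; split; first exact: num_real.
by move=> M CM w Dw; exact: le_trans (hC w Dw) (ltW CM).
Qed.

Lemma bmeasRD Y Z : bmeas D Y -> bmeas D Z ->
  \int[mu]_(w in D) (Y w + Z w) = \int[mu]_(w in D) Y w + \int[mu]_(w in D) Z w.
Proof. by move=> bY bZ; rewrite RintegralD//; exact: bmeas_integrable. Qed.

Lemma bmeasRB Y Z : bmeas D Y -> bmeas D Z ->
  \int[mu]_(w in D) (Y w - Z w) = \int[mu]_(w in D) Y w - \int[mu]_(w in D) Z w.
Proof. by move=> bY bZ; rewrite RintegralB//; exact: bmeas_integrable. Qed.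

Lemma bmeasRZ c Y : bmeas D Y ->
  \int[mu]_(w in D) (c * Y w) = c * \int[mu]_(w in D) Y w.
Proof. by move=> bY; rewrite RintegralZl//; exact: bmeas_integrable. Qed.

Lemma bmeasR_sum (s : seq nat) (Y : nat -> T -> R) : (forall i, bmeas D (Y i)) ->
  \int[mu]_(w in D) (\sum_(i <- s) Y i w) = \sum_(i <- s) \int[mu]_(w in D) Y i w.
Proof.
move=> bY; elim: s => [|i s IH].
  rewrite big_nil (@eq_Rintegral _ _ _ _ _ (fun _ => 0)) => [|w _]; last by rewrite big_nil.
  by rewrite Rintegral_cst// mul0r.
rewrite big_cons -IH -bmeasRD//; last exact: bmeas_sum.
by apply: eq_Rintegral => w _; rewrite big_cons.
Qed.

Lemma bmeasR_le Y Z : bmeas D Y -> bmeas D Z -> (forall w, D w -> Y w <= Z w) ->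
  \int[mu]_(w in D) Y w <= \int[mu]_(w in D) Z w.
Proof. by move=> bY bZ YZ; apply: le_Rintegral => //; exact: bmeas_integrable. Qed.

Lemma Rintegral_EFin Y : bmeas D Y ->
  (\int[mu]_(w in D) (Y w)%:E)%E = (\int[mu]_(w in D) Y w)%:E.
Proof.
move=> bY; rewrite /Rintegral fineK//; apply: integrable_fin_num => //.
exact: bmeas_integrable bY.
Qed.

(** Multiplying by the indicator of the complement of [N] changes neither integral and makes the
    inequality hold everywhere. *)
Lemma bmeasR_le_ae Y Z (N : set T) : measurable N -> mu N = 0%E ->
  bmeas D Y -> bmeas D Z -> (forall w, D w -> ~ N w -> Y w <= Z w) ->
  \int[mu]_(w in D) Y w <= \int[mu]_(w in D) Z w.
Proof.
move=> mN N0 bY bZ YZ.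
have h W : bmeas D W ->
    \int[mu]_(w in D) W w = \int[mu]_(w in D) (\1_(~` N) w * W w).
  move=> bW; congr fine; apply: ae_eq_integral => //.
  - by apply/measurable_EFinP; case: bW.
  - by apply/measurable_EFinP; apply: measurable_funM; [exact/measurable_indic/measurableC|case: bW].
  - exists N; split => // w /= /not_implyP[Dw]; apply: contra_notP => nN.
    by rewrite indicE mem_set ?mul1r.
rewrite (h Y)// (h Z)//; apply: bmeasR_le.
- by apply: bmeasM => //; exact/bmeas_indic/measurableC.
- by apply: bmeasM => //; exact/bmeas_indic/measurableC.
- move=> w Dw; rewrite indicE; case: (boolP (w \in ~` N)); last by rewrite !mul0r.
  by rewrite inE => nN; rewrite !mul1r; exact: YZ.
Qed.

Lemma bmeas_limit (Y : nat -> T -> R) Z (C : R) : (forall n, measurable_fun D (Y n)) ->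
  (forall n w, D w -> `|Y n w| <= C) -> (forall w, D w -> Y ^~ w @ \oo --> Z w) -> bmeas D Z.
Proof.
move=> mY bY YZ; split; first exact: measurable_fun_cvg mY YZ.
exists C => w Dw; have /cvg_norm hc := YZ _ Dw.
by apply: (@cvgr_to_le _ _ _ _ _ _ _ hc); near=> n; exact: bY.
Unshelve. all: by end_near. Qed.

Lemma bmeasR_dct (Y : nat -> T -> R) Z (C : R) : (forall n, measurable_fun D (Y n)) ->
  (forall n w, D w -> `|Y n w| <= C) -> (forall w, D w -> Y ^~ w @ \oo --> Z w) ->
  (fun n => \int[mu]_(w in D) Y n w) @ \oo --> \int[mu]_(w in D) Z w.
Proof.
move=> mY bY YZ.
have bZ := bmeas_limit mY bY YZ.
have bYn n : bmeas D (Y n) by split => //; exists C => w; exact: bY.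
have mY' n : measurable_fun D (EFin \o Y n) by exact/measurable_EFinP.
have mZ' : measurable_fun D (EFin \o Z) by apply/measurable_EFinP; case: bZ.
have YZ' : {ae mu, forall w, D w -> (EFin \o Y n) w @[n --> \oo] --> (EFin \o Z) w}.
  by apply: aeW => w Dw; apply: cvg_EFin; [exact: nearW|exact: YZ].
have bY' : {ae mu, forall w n, D w -> (`|(EFin \o Y n) w| <= C%:E)%E}.
  by apply: aeW => w n Dw; rewrite lee_fin; exact: bY.
have [_ _] := dominated_convergence mD mY' mZ' YZ'
  (bmeas_integrable (bmeas_cst C)) bY'.
rewrite Rintegral_EFin// => /fine_cvg; apply: cvg_trans.
by apply: near_eq_cvg; apply: nearW => n.
Qed.

End BoundedMeasurable.

Lemma measurable_set_le {R : realType} d (T : measurableType d) (Y Z : T -> R) :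
  measurable_fun setT Y -> measurable_fun setT Z -> measurable [set w | Y w <= Z w].
Proof.
by move=> mY mZ; rewrite -[X in measurable X]setTI; exact: measurable_fun_le.
Qed.

Lemma measurable_set_lt {R : realType} d (T : measurableType d) (Y Z : T -> R) :
  measurable_fun setT Y -> measurable_fun setT Z -> measurable [set w | Y w < Z w].
Proof.
move=> mY mZ; rewrite (_ : [set w | _] = ~` [set w | Z w <= Y w]).
  exact/measurableC/measurable_set_le.
by apply/seteqP; split => w /=; [rewrite ltNge => /negP|move/negP; rewrite -ltNge].
Qed.

Section RightContinuous.
Context {R : realType}.

(** The filter [at_right t] excludes [t], but the sequence may take the value [t]: there [phi]
    already equals its limit. *)
Lemma at_right_seq {U : topologicalType} (phi : R -> U) (t : R) (u : nat -> R) :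
  phi @ at_right t --> phi t -> (forall n, t <= u n) -> u @ \oo --> t ->
  (fun n => phi (u n)) @ \oo --> phi t.
Proof.
move=> rc tu ut A nA.
have /= := rc A nA; rewrite /at_right /nbhs/= => /nbhs_ballP[e e0 he].
have /cvgr_dist_lt/(_ e e0)[N _ hN] := ut.
exists N => // n /= Nn.
have := tu n; rewrite le_eqVlt => /predU1P[<-|tn]; first exact: nbhs_singleton.
by apply: he => //; exact: hN.
Qed.

(** The first multiple of [e] strictly after [t]. Applied to a random time it takes countably many
    values, and it tends to that time from the right as [e] tends to 0. *)
Definition grid (e t : R) : R := (Num.truncn (t / e)).+1%:R * e.

Lemma grid_gt e t : 0 < e -> t < grid e t.
Proof. by move=> e0; rewrite /grid -ltr_pdivrMr// truncnS_gt. Qed.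

Lemma grid_le e t : 0 < e -> 0 <= t -> grid e t <= t + e.
Proof.
move=> e0 t0; rewrite /grid -addn1 natrD mulrDl mul1r lerD2r -ler_pdivlMr//.
by rewrite truncn_le divr_ge0// ltW.
Qed.

(** The event splits over the countably many values of the discretised time. [U] is a bare type so
    that the lemma serves real paths and [E]-valued paths alike. *)
Lemma measurable_grid d (T : measurableType d) (U : Type) (phi : R -> T -> U) (e : R)
    (rho : T -> R) (B : set U) :
  0 < e -> measurable_fun setT rho -> (forall w, 0 <= rho w) ->
  (forall t, 0 <= t -> measurable [set w | B (phi t w)]) ->
  measurable [set w | B (phi (grid e (rho w)) w)].
Proof.
move=> e0 mrho rho0 mphi.
rewrite (_ : [set w | _] = \bigcup_(k in [set: nat])
  ([set w | k%:R * e <= rho w] `&` [set w | rho w < k.+1%:R * e] `&`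
   [set w | B (phi (k.+1%:R * e) w)])); last first.
  apply/seteqP; split => w /=.
    move=> Bw; exists (Num.truncn (rho w / e)) => //=; split => //.
    have /truncn_itv : 0 <= rho w / e by rewrite divr_ge0// ltW.
    by move=> /andP[h1 h2]; rewrite -ler_pdivlMr// -ltr_pdivrMr.
  move=> [k _ /= [[h1 h2] h3]]; rewrite /grid.
  have -> // : Num.truncn (rho w / e) = k.
  by apply: truncn_def; rewrite ler_pdivlMr// ltr_pdivrMr// h1.
apply: bigcup_measurable => k _; apply: measurableI; last first.
  by apply: mphi; rewrite mulr_ge0// ltW.
apply: measurableI.
- by apply: measurable_set_le => //; exact: measurable_cst.
- by apply: measurable_set_lt => //; exact: measurable_cst.
Qed.

Lemma grid_cvg (t : R) (e : nat -> R) : 0 <= t -> (forall n, 0 < e n) ->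
  e @ \oo --> 0 -> (fun n => grid (e n) t) @ \oo --> t.
Proof.
move=> t0 e0 ecvg; apply: (@squeeze_cvgr _ _ _ _ (fun=> t) (fun n => t + e n)).
- by apply: nearW => n; rewrite ltW ?grid_gt// grid_le.
- exact: cvg_cst.
- by rewrite -[X in _ --> X]addr0; apply: cvgD => //; exact: cvg_cst.
Qed.

Lemma measurable_sample d (T : measurableType d) (phi : R -> T -> R) (rho : T -> R) :
  measurable_fun setT rho -> (forall w, 0 <= rho w) ->
  (forall t, 0 <= t -> measurable_fun setT (phi t)) ->
  (forall w t, 0 <= t -> phi ^~ w @ at_right t --> phi t w) ->
  measurable_fun setT (fun w => phi (rho w) w).
Proof.
move=> mrho rho0 mphi rc.
apply: (@measurable_fun_cvg _ _ _ _ (fun n w => phi (grid n.+1%:R^-1 (rho w)) w)).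
- move=> n _ B mB; rewrite setTI.
  apply: (@measurable_grid _ _ _ phi _ _ B _ mrho rho0); first by rewrite invr_gt0.
  by move=> t t0; rewrite -[X in measurable X]setTI; exact: mphi.
- move=> w _; apply: (@at_right_seq _ (phi ^~ w) (rho w) (fun n => grid n.+1%:R^-1 (rho w))).
  + exact: rc.
  + by move=> n; rewrite ltW// grid_gt// invr_gt0.
  + by apply: grid_cvg => //; exact: cvg_harmonic.
Qed.

(** A single path is a process whose sample space is the time axis, sampled at [max s 0]; the
    maximum appears because right-continuity is known only at nonnegative times. *)
Lemma measurable_rc (phi : R -> R) : (forall t, 0 <= t -> phi @ at_right t --> phi t) ->
  measurable_fun setT (fun s : R => phi (Num.max s 0)).
Proof.
move=> rc; apply: (@measurable_sample _ (measurableTypeR R) (fun t _ => phi t) (fun s : R => Num.max s 0)) => //.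
- exact: measurable_maxr.
- by move=> w; rewrite le_max lexx orbT.
Qed.

Lemma measurable_rc_itv (phi : R -> R) (a b : itv_bound R) :
  (forall t, 0 <= t -> phi @ at_right t --> phi t) -> (BLeft 0 <= a)%O ->
  measurable_fun [set` Interval a b] phi.
Proof.
move=> rc a0.
apply: (@eq_measurable_fun _ _ _ _ _ (fun s : R => phi (Num.max s 0))).
  move=> s; rewrite inE /= => /andP[h _].
  have : (BLeft 0 <= BLeft s)%O by apply: le_trans a0 h.
  by rewrite bnd_simp => s0; congr phi; apply/max_idPl.
by apply: measurable_funTS; exact: measurable_rc.
Qed.

End RightContinuous.

Section TimeIntegral.
Context {R : realType} (phi : R -> R) (C : R).
Hypothesis rc : forall t, 0 <= t -> phi @ at_right t --> phi t.
Hypothesis bphi : forall t, 0 <= t -> `|phi t| <= C.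
Notation leb := (@lebesgue_measure R).

Definition timeint (r : R) : R := \int[leb]_(s in `[0, r]) phi s.

Lemma leb_itv_lty (a b : R) (x y : bool) : (leb [set` Interval (BSide x a) (BSide y b)] < +oo)%E.
Proof. by rewrite lebesgue_measure_itv/=; case: ifP => _; rewrite ?ltry. Qed.

Lemma Rintegral_cst_itv (a b : R) (x y : bool) (c : R) : a <= b ->
  \int[leb]_(s in [set` Interval (BSide x a) (BSide y b)]) c = c * (b - a).
Proof.
move=> ab; have e : leb [set` Interval (BSide x a) (BSide y b)] = (b - a)%:E.
  rewrite lebesgue_measure_itv/= lte_fin.
  move: ab; rewrite le_eqVlt => /predU1P[->|->]; first by rewrite ltxx subrr.
  by [].
by rewrite Rintegral_cst//; congr (c * _); exact: (congr1 fine e).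
Qed.

Lemma bmeas_path (a b : R) (x y : bool) : 0 <= a ->
  bmeas [set` Interval (BSide x a) (BSide y b)] phi.
Proof.
move=> a0; split; first by apply: measurable_rc_itv => //; case: x; rewrite bnd_simp.
exists C => s /=; rewrite itv_boundlr => /andP[h _]; apply: bphi.
by apply: le_trans a0 _; case: x h; rewrite bnd_simp // => /ltW.
Qed.

Lemma integrable_path (a b : R) (x y : bool) : 0 <= a ->
  leb.-integrable [set` Interval (BSide x a) (BSide y b)] (EFin \o phi).
Proof.
move=> a0; apply: bmeas_integrable => //; first exact: leb_itv_lty.
exact: bmeas_path.
Qed.

Lemma timeintB (a b : R) : 0 <= a -> a <= b ->
  timeint b - timeint a = \int[leb]_(s in `[a, b]) phi s.
Proof.
move=> a0 ab; rewrite /timeint Rintegral_itvB ?bnd_simp//; last exact: integrable_path.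
by rewrite Rintegral_itv_obnd_cbnd//; exact: integrable_path.
Qed.

Lemma timeint_lip (a b : R) : 0 <= a -> a <= b ->
  `|timeint b - timeint a| <= C * (b - a).
Proof.
move=> a0 ab; rewrite timeintB//.
apply: le_trans (le_normr_Rintegral _ _) _ => //; first exact: integrable_path.
rewrite -(@Rintegral_cst_itv a b true false C ab).
have [mp [K hK]] := @bmeas_path a b true false a0.
apply: (@bmeasR_le _ _ _ _ leb) => //; first exact: leb_itv_lty.
- by split; [exact: measurableT_comp | exists K => s /hK; rewrite normr_id].
- exact: bmeas_cst.
- by move=> s /=; rewrite in_itv/= => /andP[h _]; apply: bphi; exact: le_trans h.
Qed.

Lemma timeint0 : timeint 0 = 0.
Proof. by rewrite /timeint set_itv1 Rintegral_set1. Qed.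

Lemma timeint_bound r : 0 <= r -> `|timeint r| <= C * r.
Proof. by move=> r0; have := @timeint_lip 0 r (lexx _) r0; rewrite timeint0 !subr0. Qed.

Lemma timeint_dist (a b : R) : 0 <= a -> 0 <= b -> `|timeint a - timeint b| <= C * `|a - b|.
Proof.
move=> a0 b0; case: (leP a b) => ab.
  by rewrite distrC [`|a - b|]distrC [`|b - a|]ger0_norm ?subr_ge0//; exact: timeint_lip.
by rewrite [`|a - b|]gtr0_norm ?subr_gt0//; apply: timeint_lip => //; exact: ltW.
Qed.

Lemma timeint_cvg (u : nat -> R) (t : R) : (forall n, 0 <= u n) -> 0 <= t ->
  u @ \oo --> t -> (fun n => timeint (u n)) @ \oo --> timeint t.
Proof.
move=> u0 t0 ut; apply/subr_cvg0.
apply: norm_cvg0; apply: (@squeeze_cvgr _ _ _ _ (fun=> 0) (fun n => C * `|u n - t|)).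
- by apply: nearW => n; rewrite normr_ge0 timeint_dist.
- exact: cvg_cst.
- rewrite -(mulr0 C); apply: cvgM; first exact: cvg_cst.
  by rewrite -(normr0 R); apply: cvg_norm; apply/subr_cvg0.
Qed.

Lemma timeint_rc t : 0 <= t -> timeint @ at_right t --> timeint t.
Proof.
move=> t0; apply/cvg_at_rightP => u [ut cu]; apply: timeint_cvg => //.
by move=> n; exact: le_trans t0 (ltW (ut n)).
Qed.

(** Right-endpoint sums converge for every bounded right-continuous path: each sum is the integral
    of the path read at the next grid point, and these step functions converge pointwise. *)
Lemma riemann_sum (a h : R) : 0 <= a -> 0 < h ->
  (fun k => \sum_(0 <= i < k.+1) (h / k.+1%:R) * phi (a + i.+1%:R * (h / k.+1%:R)))
    @ \oo --> timeint (a + h) - timeint a.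
Proof.
move=> a0 h0.
rewrite timeintB ?lerDl ?(ltW h0)//.
(* The half-open interval splits into disjoint cells, each closed on the left, on which [psi] is
   constant. *)
rewrite -Rintegral_itv_bndo_bndc; last exact: integrable_path.
pose e k : R := h / k.+1%:R; have e0 k : 0 < e k by rewrite divr_gt0.
pose psi k s := phi (a + grid (e k) (Num.max (s - a) 0)).
have mpsi k : measurable_fun setT (psi k).
  move=> _ B mB; rewrite setTI.
  apply: (@measurable_grid _ _ _ _ (fun t _ => phi (a + t)) _ (fun s : R => Num.max (s - a) 0)) => //.
  - by apply: measurable_maxr => //; apply: measurable_funB.
  - by move=> w; rewrite le_max lexx orbT.
  - move=> t t0; case: (pselect (B (phi (a + t)))) => hB.
      by rewrite (_ : [set _ | _] = setT)//; apply/seteqP; split.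
    by rewrite (_ : [set _ | _] = set0)//; apply/seteqP; split.
have ps0 k s : 0 <= a + grid (e k) (Num.max (s - a) 0).
  by rewrite addr_ge0// /grid mulr_ge0// ltW.
have bpsi k s : `|psi k s| <= C by apply: bphi.
have -> : (fun k => \sum_(0 <= i < k.+1) (h / k.+1%:R) * phi (a + i.+1%:R * (h / k.+1%:R))) =
    fun k => \int[leb]_(s in `[a, a + h[) psi k s.
  apply/funext => k.
  suff H m : \int[leb]_(s in `[a, a + m%:R * e k[) psi k s =
      \sum_(0 <= i < m) e k * phi (a + i.+1%:R * e k).
    by rewrite -/(e k) -H /e mulrCA divff// mulr1.
  elim: m => [|m IH].
    by rewrite big_geq// mul0r addr0 set_itv_ge ?bnd_simp// Rintegral_set0.
  rewrite big_nat_recr//= -IH.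
  have l1 : a <= a + m%:R * e k by rewrite lerDl mulr_ge0// ltW.
  have l2 : a + m%:R * e k <= a + m.+1%:R * e k.
    by rewrite lerD2l ler_pM2r// ler_nat.
  rewrite (@itv_bndbnd_setU _ _ _ (BLeft (a + m%:R * e k))) ?bnd_simp//.
  rewrite Rintegral_setU//=; last 2 first.
  - rewrite -itv_bndbnd_setU ?bnd_simp//.
    have bps : bmeas `[a, a + m.+1%:R * e k[ (psi k) by split; [apply: measurable_funTS; exact: mpsi|exists C].
    by apply: bmeas_integrable; [exact: measurable_itv|exact: leb_itv_lty|exact: bps].
  - apply/disj_setPS => y [/=]; rewrite 2!in_itv/= => /andP[_ yx] /andP[].
    by rewrite leNgt yx.
  congr (_ + _).
  rewrite (@eq_Rintegral _ _ _ _ _ (fun _ => phi (a + m.+1%:R * e k))).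
    rewrite Rintegral_cst_itv// mulrC; congr (_ * _).
    by rewrite -[m.+1]addn1 natrD; ring.
  move=> s; rewrite inE/= in_itv/= => /andP[s1 s2]; rewrite /psi /grid.
  have -> : Num.max (s - a) 0 = s - a.
    by apply/max_idPl; rewrite subr_ge0; exact: le_trans s1.
  have -> // : Num.truncn ((s - a) / e k) = m.
  by apply: truncn_def; rewrite ler_pdivlMr// ltr_pdivrMr// lerBrDl s1 ltrBlDl.
apply: (@bmeasR_dct _ _ _ _ leb _ _ psi phi C) => //.
- exact: leb_itv_lty.
- by move=> n; apply: measurable_funTS; exact: mpsi.
- move=> s /=; rewrite in_itv/= => /andP[s1 _].
  have sa : Num.max (s - a) 0 = s - a by apply/max_idPl; rewrite subr_ge0.
  rewrite /psi sa; apply: (@at_right_seq _ _ phi s (fun k => a + grid (e k) (s - a))).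
  + by apply: rc; exact: le_trans s1.
  + by move=> n; rewrite -lerBlDl ltW// grid_gt.
  + rewrite -[X in _ --> X](subrKC a); apply: cvgD; first exact: cvg_cst.
    apply: grid_cvg => //; first by rewrite subr_ge0.
    rewrite -(mulr0 h); apply: cvgM; [exact: cvg_cst|exact: cvg_harmonic].
Qed.

End TimeIntegral.

(** * The Markov process and stopping times *)

Section SigmaAlgebra.
Context {T : Type} (G : set (set T)).
Hypothesis sG : sigma_algebra [set: T] G.

Lemma salg0 : G set0.
Proof. by case: sG. Qed.

Lemma salgC A : G A -> G (~` A).
Proof. by case: sG => _ hC _ GA; rewrite -setTD; exact: hC. Qed.

Lemma salgT : G setT.
Proof. by rewrite -setC0; exact/salgC/salg0. Qed.

Lemma salg_bigcup (A : nat -> set T) : (forall n, G (A n)) -> G (\bigcup_n A n).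
Proof. by case: sG => _ _; apply. Qed.

Lemma salg_bigcap (A : nat -> set T) : (forall n, G (A n)) -> G (\bigcap_n A n).
Proof.
move=> GA; rewrite -[X in G X]setCK setC_bigcap; apply/salgC/salg_bigcup => n.
exact/salgC/GA.
Qed.

Lemma salgU A B : G A -> G B -> G (A `|` B).
Proof.
move=> GA GB; rewrite -bigcup2E; apply: salg_bigcup => -[|[|n]] //=; exact: salg0.
Qed.

Lemma salgI A B : G A -> G B -> G (A `&` B).
Proof. by move=> GA GB; rewrite -[X in G X]setCK setCI; apply/salgC/salgU; exact: salgC. Qed.

Lemma salgD A B : G A -> G B -> G (A `\` B).
Proof. by move=> GA GB; rewrite setDE; apply: salgI => //; exact: salgC. Qed.

Lemma salg_const (b : Prop) : G [set _ | b].
Proof.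
case: (pselect b) => hb.
  by rewrite (_ : [set _ | b] = setT); [exact: salgT|apply/seteqP; split].
by rewrite (_ : [set _ | b] = set0); [exact: salg0|apply/seteqP; split].
Qed.

Lemma salg_bigcup_rat (D : set rat) (A : rat -> set T) :
  (forall q, D q -> G (A q)) -> G (\bigcup_(q in D) A q).
Proof.
move=> GA; rewrite (_ : \bigcup_(q in D) A q =
  \bigcup_n (if unpickle n is Some q then [set w | D q] `&` A q else set0)).
  apply: salg_bigcup => n; case: unpickle => [q|]; last exact: salg0.
  case: (pselect (D q)) => hq; first by apply: salgI; [exact: salg_const|exact: GA].
  by rewrite (_ : _ `&` _ = set0); [exact: salg0|apply/seteqP; split => // w []].
apply/seteqP; split => w.
  move=> [q Dq Aq]; exists (pickle q); first exact: I.
  by rewrite pickleK; split.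
by move=> [n _]; case: unpickle => // q [Dq Aq]; exists q.
Qed.

End SigmaAlgebra.

(** * Consequences of the process axioms; sampling the state at a random time *)

Section Markov.
Context {R : realType} {E : pmetricType R} {dO : measure_display}
  {Omega : measurableType dO}.
Variables (P : E -> probability Omega R) (X : R -> Omega -> E)
  (F : R -> set (set Omega)).
Notation borelE := (g_sigma_algebraType (@open E)).

Definition cb (phi : E -> R) := continuous phi /\ exists C : R, forall y, `|phi y| <= C.

Definition expect (x : E) (Y : Omega -> R) : R := \int[P x]_w Y w.

Lemma Plty x : (P x [set: Omega] < +oo)%E.
Proof. by apply: (@le_lt_trans _ _ 1%E); [exact: probability_le1|exact: ltry]. Qed.

Lemma expect_cst x c : expect x (fun=> c) = c.
Proof. by rewrite /expect Rintegral_cst// (congr1 fine (probability_setT (P x))) mulr1. Qed.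

Lemma expect_eq x Y Z : Y =1 Z -> expect x Y = expect x Z.
Proof. by move=> YZ; congr expect; exact/funext. Qed.

Lemma expectD x Y Z : bmeas setT Y -> bmeas setT Z ->
  expect x (fun w => Y w + Z w) = expect x Y + expect x Z.
Proof. by move=> bY bZ; apply: bmeasRD => //; exact: Plty. Qed.

Lemma expectB x Y Z : bmeas setT Y -> bmeas setT Z ->
  expect x (fun w => Y w - Z w) = expect x Y - expect x Z.
Proof. by move=> bY bZ; apply: bmeasRB => //; exact: Plty. Qed.

Lemma expectZ x c Y : bmeas setT Y -> expect x (fun w => c * Y w) = c * expect x Y.
Proof. by move=> bY; apply: bmeasRZ => //; exact: Plty. Qed.

Lemma expect_sum x (s : seq nat) (Y : nat -> Omega -> R) : (forall i, bmeas setT (Y i)) ->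
  expect x (fun w => \sum_(i <- s) Y i w) = \sum_(i <- s) expect x (Y i).
Proof. by move=> bY; apply: bmeasR_sum => //; exact: Plty. Qed.

Lemma expect_le x Y Z : bmeas setT Y -> bmeas setT Z -> (forall w, Y w <= Z w) ->
  expect x Y <= expect x Z.
Proof. by move=> bY bZ YZ; apply: bmeasR_le => //; exact: Plty. Qed.

Lemma expect_dct x (Y : nat -> Omega -> R) Z (C : R) :
  (forall n, measurable_fun setT (Y n)) ->
  (forall n w, `|Y n w| <= C) -> (forall w, Y ^~ w @ \oo --> Z w) ->
  (fun n => expect x (Y n)) @ \oo --> expect x Z.
Proof. by move=> mY bY YZ; apply: (@bmeasR_dct _ _ _ _ (P x) _ _ _ _ C) => //; exact: Plty. Qed.

Lemma expect_dist x Y Z (e : R) : bmeas setT Y -> bmeas setT Z ->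
  (forall w, `|Y w - Z w| <= e) -> `|expect x Y - expect x Z| <= e.
Proof.
move=> bY bZ YZ; rewrite ler_distl; apply/andP; split.
  rewrite -[X in _ - X](expect_cst x) -expectB//; last exact: bmeas_cst.
  apply: expect_le => // [|w]; first by apply: bmeasB => //; exact: bmeas_cst.
  by have := YZ w; rewrite ler_distl => /andP[].
rewrite -[X in _ + X](expect_cst x) -expectD//; last exact: bmeas_cst.
apply: expect_le => // [|w]; first by apply: bmeasD => //; exact: bmeas_cst.
by have := YZ w; rewrite ler_distl => /andP[].
Qed.

Lemma continuous_borel (phi : E -> R) : continuous phi ->
  measurable_fun [set: borelE] (phi : borelE -> R).
Proof.
move=> /continuousP cphi; apply: (measurability _ (RGenOpens.measurableE R)).
move=> _ [_ [a [b ->]] <-]; rewrite setTI; apply: sub_sigma_algebra.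
exact/cphi/interval_open.
Qed.

Lemma borel_ge (phi : E -> R) (c : R) : continuous phi ->
  measurable ([set y | c <= phi y] : set borelE).
Proof.
move=> cphi; apply: (@measurable_set_le _ _ borelE (fun=> c) phi).
  exact: measurable_cst.
exact: continuous_borel.
Qed.

Lemma borel_lt (phi psi : E -> R) : continuous phi -> continuous psi ->
  measurable ([set y | phi y < psi y] : set borelE).
Proof.
by move=> cphi cpsi; apply: (@measurable_set_lt _ _ borelE phi psi); exact: continuous_borel.
Qed.

Hypothesis mk : standard_markov P X F.

Lemma filt_salg t : 0 <= t -> sigma_algebra [set: Omega] (F t).
Proof. by case: mk => -[h _] _; exact: h. Qed.

Lemma filt_meas t A : 0 <= t -> F t A -> measurable A.
Proof. by case: mk => -[_ [h _]] _ t0; exact: h. Qed.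

Lemma filt_mono s t A : 0 <= s -> s <= t -> F s A -> F t A.
Proof. by case: mk => -[_ [_ h]] _ s0 st; exact: h. Qed.

Lemma filt_rc t A : 0 <= t -> (forall s, t < s -> F s A) -> F t A.
Proof. by case: mk => _ [h _] t0; exact: h. Qed.

Lemma adapted t (B : set borelE) : 0 <= t -> measurable B -> F t (X t @^-1` B).
Proof. by case: mk => _ [_ [_ [h _]]] t0; exact: h. Qed.

Lemma start x : P x [set w | X 0 w = x] = 1%E.
Proof. by case: mk => _ [_ [_ [_ [h _]]]]. Qed.

Lemma path_rc w t : 0 <= t -> (fun s => X s w) @ at_right t --> X t w.
Proof. by case: mk => _ [_ [_ [_ [_ [h _]]]]]; exact: h. Qed.

Lemma path_ll w t : 0 < t -> exists l : E, (fun s => X s w) @ at_left t --> l.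
Proof. by case: mk => _ [_ [_ [_ [_ [_ [h _]]]]]]; exact: h. Qed.

Lemma kernel_meas s (B : set borelE) : 0 <= s -> measurable B ->
  measurable_fun [set: borelE] (fun y : borelE => P y (X s @^-1` B)).
Proof. by case: mk => _ [_ [_ [_ [_ [_ [_ [h _]]]]]]] s0; exact: h. Qed.

Lemma state_meas t (B : set borelE) : 0 <= t -> measurable B -> measurable (X t @^-1` B).
Proof. by move=> t0 mB; apply: (@filt_meas t) => //; exact: adapted. Qed.

Lemma fpath_rc (phi : E -> R) w t : continuous phi -> 0 <= t ->
  (fun s => phi (X s w)) @ at_right t --> phi (X t w).
Proof. by move=> cphi t0; apply: continuous_cvg; [exact: cphi|exact: path_rc]. Qed.

Lemma fpath_meas (phi : E -> R) t : continuous phi -> 0 <= t ->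
  measurable_fun setT (fun w => phi (X t w)).
Proof.
move=> cphi t0 _ B mB; rewrite setTI.
have := @continuous_borel phi cphi measurableT B mB; rewrite setTI.
exact: state_meas.
Qed.

Lemma sample_meas (phi : E -> R) (rho : Omega -> R) : continuous phi ->
  measurable_fun setT rho -> (forall w, 0 <= rho w) ->
  measurable_fun setT (fun w => phi (X (rho w) w)).
Proof.
move=> cphi mrho rho0; apply: (@measurable_sample _ _ _ (fun t w => phi (X t w)) rho) => //.
  by move=> t t0; exact: fpath_meas.
by move=> w t t0; exact: fpath_rc.
Qed.

Lemma sample_bmeas (phi : E -> R) (rho : Omega -> R) : cb phi ->
  measurable_fun setT rho -> (forall w, 0 <= rho w) ->
  bmeas setT (fun w => phi (X (rho w) w)).
Proof. by move=> [cphi [C hC]] mrho rho0; split; [exact: sample_meas|exists C]. Qed.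

(* For an open set U, membership of a limit in U is detected along the sequence
   by the closed sets of points at distance at least 1/k from the complement of U. *)
Lemma sample_borel (rho : Omega -> R) (B : set borelE) :
  measurable_fun setT rho -> (forall w, 0 <= rho w) -> measurable B ->
  measurable [set w | B (X (rho w) w)].
Proof.
move=> mrho rho0 mB.
have mX : measurable_fun setT (fun w => X (rho w) w : borelE).
  apply: (@measurability _ _ Omega borelE setT _ (@open E) erefl) => _ [U oU <-].
  rewrite setTI.
  pose V (k : nat) := [set y : E | exists2 z : E, ~ U z & mdist y z < k.+1%:R^-1].
  have oV k : open (V k).
    rewrite openE => y [z Uz yz]; rewrite /interior; apply/nbhs_ballP.
    exists (k.+1%:R^-1 - mdist y z); first by rewrite /= subr_gt0.
    move=> y'; rewrite ballEmdist/= ltrBrDr => h; exists z => //.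
    apply: le_lt_trans h; rewrite (metric_sym y y').
    exact: metric_triangle.
  pose r n w := grid n.+1%:R^-1 (rho w).
  have mS k n : measurable [set w | ~ V k (X (r n w) w)].
    apply: (@measurable_grid _ _ _ _ X _ rho (~` V k)) => //.
    have mV : measurable (~` V k : set borelE).
      by apply: measurableC; apply: sub_sigma_algebra; exact: oV.
    by move=> t t0; exact: (@state_meas t (~` V k)).
  have rcv w : (fun n => X (r n w) w) @ \oo --> X (rho w) w.
    apply: (@at_right_seq _ _ (fun s => X s w) (rho w) (fun n => r n w)).
    + exact: path_rc.
    + by move=> n; rewrite ltW// grid_gt// invr_gt0.
    + by apply: grid_cvg => //; exact: cvg_harmonic.
  rewrite (_ : _ @^-1` U = \bigcup_k \bigcup_m \bigcap_n
      [set w | ~ V k (X (r (m + n)%N w) w)]).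
    apply: bigcupT_measurable => k; apply: bigcupT_measurable => m.
    by apply: bigcapT_measurable => n; exact: mS.
  apply/seteqP; split => w /=.
    move=> Uw; have /nbhs_ballP[e /= e0 he] : nbhs (X (rho w) w) U by exact: open_nbhs_nbhs.
    have e20 : 0 < e / 2 by rewrite divr_gt0.
    have [k _ hk] := near_infty_natSinv_lt (PosNum e20).
    have [m _ hm] := rcv w _ (nbhsx_ballx _ _ e20).
    exists k => //; exists m => //; move=> n _ /= [z Uz hz]; apply: Uz; apply: he.
    have h1 : ball (X (rho w) w) (e / 2) (X (r (m + n)%N w) w).
      by apply: hm; rewrite /= leq_addr.
    move: h1; rewrite !ballEmdist/= => h1.
    rewrite (splitr e); apply: le_lt_trans (ltrD h1 (lt_trans hz (hk k (leqnn _)))).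
    exact: metric_triangle.
  move=> [k _ [m _ hm]]; apply: contrapT => Uw.
  have nV : nbhs (X (rho w) w) (V k).
    apply: open_nbhs_nbhs; split; first exact: oV.
    by exists (X (rho w) w) => //; rewrite mdistxx invr_gt0.
  have [m' _ hm'] := rcv w _ nV.
  apply: (hm m' I) => /=; apply: hm' => /=; exact: leq_addl.
by have := mX measurableT B mB; rewrite setTI.
Qed.

(** Finite stopping times are kept real-valued, so that paths and path integrals are evaluated at
    them without [fine]. *)
Definition rst (rho : Omega -> R) : Prop :=
  (forall w, 0 <= rho w) /\ (forall t, 0 <= t -> F t [set w | rho w <= t]).

Lemma rst_stopping rho : rst rho <-> stopping_time F (fun w => (rho w)%:E).
Proof.
split=> -[h1 h2]; split; first by move=> w; rewrite lee_fin.
- move=> t t0; rewrite (_ : [set w | _] = [set w | rho w <= t]); first exact: h2.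
  by apply/seteqP; split => w /=; rewrite lee_fin.
- by move=> w; rewrite -lee_fin.
- move=> t t0; rewrite (_ : [set w | _] = [set w | ((rho w)%:E <= t%:E)%E]); first exact: h2.
  by apply/seteqP; split => w /=; rewrite lee_fin.
Qed.

Lemma stopping_meas (tau : Omega -> \bar R) : stopping_time F tau -> measurable_fun setT tau.
Proof.
move=> [tau0 ht].
apply: (measurability _ (ErealGenOInfty.measurableE R)) => _ [_ [t ->] <-].
rewrite setTI (_ : _ @^-1` _ = ~` [set w | (tau w <= t%:E)%E]); last first.
  apply/seteqP; split => w /=; rewrite in_itv/= andbT ltNge; first by move/negP.
  by move/negP.
apply: measurableC; case: (leP 0 t) => t0; first exact: filt_meas (ht t t0).
rewrite (_ : [set w | _] = set0)//; apply/seteqP; split => // w /= h.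
by have := le_trans (tau0 w) h; rewrite lee_fin leNgt t0.
Qed.

Lemma rst_meas rho : rst rho -> measurable_fun setT rho.
Proof. by move=> /rst_stopping/stopping_meas/measurable_EFinP. Qed.

End Markov.

(** * The semigroup on bounded continuous functions *)

Section Staircase.
Context {R : realType}.

(** A discrete layer cake. Composed with a function it becomes a combination of indicators of
    superlevel sets, to which the Markov property for sets applies. *)
Definition stair (n : nat) (e v : R) : R :=
  \sum_(0 <= i < n) e * (i.+1%:R * e <= v)%R%:R.

Lemma stairP (n : nat) (e v : R) : 0 < e -> 0 <= v -> v <= n%:R * e ->
  stair n e v <= v <= stair n e v + e.
Proof.
move=> e0 v0; rewrite le_eqVlt => h.
(* The induction follows whether [v] has reached level [m]: if so all [m] terms are present, if not
   the later terms vanish and the earlier bound persists. *)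
have H m : (m%:R * e <= v -> stair m e v = m%:R * e) /\
    (v < m%:R * e -> stair m e v <= v <= stair m e v + e).
  elim: m => [|m [IH1 IH2]].
    by rewrite /stair big_geq// mul0r; split=> //; rewrite ltNge v0.
  rewrite /stair big_nat_recr//= -/(stair m e v); split=> hv.
    rewrite hv mulr1 IH1; last by apply: le_trans hv; rewrite ler_pM2r// ler_nat.
    by rewrite -addn1 natrD; ring.
  have -> : (m.+1%:R * e <= v) = false by apply/negbTE; rewrite -ltNge.
  rewrite mulr0 addr0; case: (ltP v (m%:R * e)) => hm; first exact: IH2.
  rewrite IH1// hm/=; apply: ltW; apply: lt_le_trans hv _.
  by rewrite -addn1 natrD mulrDl mul1r.
case/orP: h => [/eqP h|]; last by move/(H n).2.
by have := (H n).1; rewrite -h lexx => /(_ isT) ->; rewrite lexx lerDl ltW.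
Qed.

End Staircase.

Lemma le_eps_inv {R : realType} (a c : R) : 0 <= c ->
  (forall n : nat, a <= c / n.+1%:R) -> a <= 0.
Proof.
move=> c0 h; have hc : (fun n => c / n.+1%:R) @ \oo --> (0 : R).
  rewrite -(mulr0 c); apply: cvgM; [exact: cvg_cst|exact: cvg_harmonic].
by apply: (cvgr_to_ge hc); exact: nearW.
Qed.

Section MetricContinuity.
Context {R : realType} {E : pmetricType R}.

(** Dominated convergence is a statement on sequences, so continuity in the state of an integral is
    tested along sequences. *)
Lemma seq_continuous (phi : E -> R) :
  (forall (u : nat -> E) (x : E), u @ \oo --> x -> (fun n => phi (u n)) @ \oo --> phi x) ->
  continuous phi.
Proof.
move=> h x; apply: contrapT => nc.
have [e e0 he] : exists2 e : R, 0 < e & forall n : nat, exists y : E,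
    mdist x y < n.+1%:R^-1 /\ e <= `|phi x - phi y|.
  apply: contrapT => hn; apply: nc; apply/cvgrPdist_lt => e e0.
  have [n hn'] : exists n : nat, forall y : E, mdist x y < n.+1%:R^-1 -> `|phi x - phi y| < e.
    apply: contrapT => hm; apply: hn; exists e => // n.
    apply: contrapT => hy; apply: hm; exists n => y xy.
    by rewrite ltNge; apply/negP => ey; apply: hy; exists y.
  apply/nbhs_ballP; exists n.+1%:R^-1 => /=; first by rewrite invr_gt0.
  by move=> y; rewrite ballEmdist/=; exact: hn'.
pose u n := projT1 (cid (he n)).
have hu n : mdist x (u n) < n.+1%:R^-1 /\ e <= `|phi x - phi (u n)|.
  by rewrite /u; case: cid.
have ux : u @ \oo --> x.
  move=> A /nbhs_ballP[d /= d0 hd].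
  have [N _ hN] := near_infty_natSinv_lt (PosNum d0).
  exists N => // n /= Nn; apply: hd; rewrite ballEmdist/=.
  exact: lt_trans (hu n).1 (hN n Nn).
have /cvgrPdist_lt/(_ e e0)[N _ hN] := h u x ux.
by have := hN N (leqnn N); rewrite /= ltNge (hu N).2.
Qed.

Lemma mdist_continuous (x0 : E) : continuous (fun y : E => mdist x0 y).
Proof.
move=> y; apply/cvgrPdist_lt => e e0; apply/nbhs_ballP; exists e => // z.
rewrite ballEmdist/= => yz; apply: le_lt_trans yz; rewrite ler_norml.
have h1 := metric_triangle x0 y z; have h2 := metric_triangle x0 z y.
by move: h2; rewrite (metric_sym z y) => h2; apply/andP; split; lra.
Qed.

(** Closed balls are compact, so this continuous function has compact support; multiplying by it
    brings a bounded continuous function into C0. *)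
Definition cutoff (k : nat) (y : E) : R :=
  Num.max 0 (Num.min 1 (k.+1%:R - mdist (point : E) y)).

Lemma continuous_maxr (phi psi : E -> R) : continuous phi -> continuous psi ->
  continuous (fun y => Num.max (phi y) (psi y)).
Proof. by move=> cphi cpsi y; exact: (continuous_max (cphi y) (cpsi y)). Qed.

Lemma cutoff_continuous k : continuous (cutoff k).
Proof.
apply: continuous_maxr; first by move=> y; exact: cst_continuous.
move=> y; apply: (@continuous_min _ _ (fun=> 1) (fun z => k.+1%:R - mdist (point : E) z)).
  exact: cst_continuous.
by apply: (@continuousB _ R^o); [exact: cst_continuous|exact: mdist_continuous].
Qed.

Lemma cutoff_01 k y : 0 <= cutoff k y <= 1.
Proof. by rewrite /cutoff le_max lexx/= ge_max ler01/= ge_min lexx. Qed.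

Lemma cutoff_eq1 k y : mdist (point : E) y <= k%:R -> cutoff k y = 1.
Proof.
move=> h; rewrite /cutoff (min_idPl _); last by rewrite -addn1 natrD; lra.
by apply/max_idPr.
Qed.

Lemma cutoff_eq0 k y : k.+1%:R <= mdist (point : E) y -> cutoff k y = 0.
Proof. by move=> h; apply/max_idPl; rewrite ge_min subr_le0 h orbT. Qed.

Lemma C0_cutoff (phi : E -> R) k : nice_space E -> cb phi ->
  C0 (fun y => phi y * cutoff k y).
Proof.
move=> [_ [_ cpt]] [cphi [C hC]]; split; last split.
- by move=> y; apply: continuousM; [exact: cphi|exact: cutoff_continuous].
- exists C => y; rewrite normrM; have /andP[h0 h1] := cutoff_01 k y.
  by rewrite (ger0_norm h0) -[C]mulr1 ler_pM.
- move=> e e0; exists (closed_dball (point : E) k.+1%:R); split; first exact: cpt.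
  move=> y /negP; rewrite -ltNge => h.
  by rewrite cutoff_eq0 ?mulr0 ?normr0// ltW.
Qed.

End MetricContinuity.

(** * The Feller property on bounded continuous functions; the Markov property for sets *)

Section Semigroup.
Context {R : realType} {E : pmetricType R} {dO : measure_display}
  {Omega : measurableType dO}.
Variables (P : E -> probability Omega R) (X : R -> Omega -> E)
  (F : R -> set (set Omega)).
Notation borelE := (g_sigma_algebraType (@open E)).
Hypothesis nice : nice_space E.
Hypothesis mk : standard_markov P X F.
Hypothesis fel : weak_feller P X.

Lemma cb_path t phi : 0 <= t -> cb phi -> bmeas setT (fun w => phi (X t w)).
Proof.
by move=> t0 [cphi [C hC]]; split; [exact: (fpath_meas mk)|exists C => w _; exact: hC].
Qed.

Lemma semigroup_le t phi psi x : 0 <= t -> cb phi -> cb psi ->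
  (forall y, phi y <= psi y) -> semigroup P X t phi x <= semigroup P X t psi x.
Proof. by move=> t0 bphi bpsi h; apply: (@expect_le _ _ _ _ P) => //; exact: cb_path. Qed.

Lemma semigroup_bound t phi x C : 0 <= t -> continuous phi -> (forall y, `|phi y| <= C) ->
  `|semigroup P X t phi x| <= C.
Proof.
move=> t0 cphi hC; rewrite -[semigroup _ _ _ _ _]subr0 -(expect_cst P x 0).
apply: (@expect_dist _ _ _ _ P); first by apply: cb_path => //; split => //; exists C.
- exact: bmeas_cst.
- by move=> w; rewrite subr0.
Qed.

(** Replacing [phi] by [phi * cutoff k] costs at most [C * (1 - P_t (cutoff k))]. This error is
    small at [x] for large [k] by dominated convergence and is itself continuous in the state by the
    weak Feller property, so it stays small near [x]. *)
Lemma semigroup_cb t phi : 0 <= t -> cb phi -> cb (semigroup P X t phi).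
Proof.
move=> t0 bphi; have [cphi [K hC0]] := bphi.
split; last by exists K => y; exact: semigroup_bound.
pose C := `|K| + 1; have Cp : 0 < C by rewrite ltr_wpDl.
have hC y : `|phi y| <= C.
  by apply: le_trans (hC0 y) _; apply: le_trans (ler_norm _) _; rewrite lerDl.
have cbc k : cb (@cutoff R E k).
  split; first exact: cutoff_continuous.
  by exists 1 => y; have /andP[h0 h1] := cutoff_01 k y; rewrite ger0_norm.
have cbp k : cb (fun y => phi y * cutoff k y).
  by have [h1 [h2 _]] := C0_cutoff k nice bphi.
have cb1 : cb (fun _ : E => 1 : R) by split; [exact: cst_continuous|exists 1 => y; rewrite normr1].
have close k y : `|semigroup P X t phi y - semigroup P X t (fun z => phi z * cutoff k z) y|
    <= C * (1 - semigroup P X t (cutoff k) y).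
  have -> : C * (1 - semigroup P X t (cutoff k) y) =
      expect P y (fun w => C * (1 - cutoff k (X t w))).
    have bc : bmeas setT (fun w => cutoff k (X t w)) by apply: cb_path.
    rewrite expectZ; last by apply: bmeasB => //; exact: bmeas_cst.
    by rewrite expectB ?expect_cst//; exact: bmeas_cst.
  have b1 := cb_path t0 bphi; have b2 := cb_path t0 (cbp k); have b3 := cb_path t0 (cbc k).
  have bR : bmeas setT (fun w => C * (1 - cutoff k (X t w))).
    by apply: bmeasZ; apply: bmeasB => //; exact: bmeas_cst.
  rewrite /semigroup -/(expect P y (fun w => phi (X t w)))
    -/(expect P y (fun w => phi (X t w) * cutoff k (X t w))) -expectB//.
  have pw w : `|phi (X t w) - phi (X t w) * cutoff k (X t w)| <= C * (1 - cutoff k (X t w)).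
    have /andP[h0 h1] := cutoff_01 k (X t w).
    rewrite -[X in `|X - _|]mulr1 -mulrBr normrM [`|1 - _|]ger0_norm ?subr_ge0//.
    by rewrite ler_wpM2r// subr_ge0.
  rewrite ler_norml; apply/andP; split.
    rewrite lerNl -[X in X <= _]mulN1r -expectZ; last exact: bmeasB.
    apply: expect_le => //; first by apply: bmeasZ; exact: bmeasB.
    by move=> w; have := pw w; rewrite ler_norml => /andP[]; rewrite mulN1r lerNl.
  apply: expect_le => //; first exact: bmeasB.
  by move=> w; apply: le_trans (ler_norm _) (pw w).
move=> x; apply/cvgrPdist_lt => e e0.
(* The truncation error is at most [C * d = e / 8] at [x] and at most [2 * C * d = e / 4] at a
   nearby [y]; with [e / 4] for the truncated functions the total stays below [e]. *)
pose d := e / (8 * C); have d0 : 0 < d by rewrite divr_gt0// mulr_gt0.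
have e4 : 0 < e / 4 by rewrite divr_gt0.
have tocut : (fun k => semigroup P X t (cutoff k) x) @ \oo --> (1 : R).
  rewrite -[X in _ --> X](expect_cst P x 1).
  apply: (@expect_dct _ _ _ _ P x (fun k w => cutoff k (X t w)) _ 1).
  - by move=> n; have [] := cb_path t0 (cbc n).
  - by move=> n w; have /andP[h0 h1] := cutoff_01 n (X t w); rewrite ger0_norm.
  - move=> w; apply: cvg_near_cst; exists (Num.truncn (mdist (point : E) (X t w))).+1 => //.
    move=> n /= hn; apply: cutoff_eq1; apply: ltW.
    by apply: lt_le_trans (truncnS_gt _) _; rewrite ler_nat.
have /cvgrPdist_lt/(_ d d0)[k _ hk] := tocut.
have {}hk := hk k (leqnn k).
have c1 : C0 (@cutoff R E k).
  have := C0_cutoff k nice cb1; rewrite (_ : (fun y => _) = cutoff k)//.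
  by apply/funext => y; rewrite mul1r.
have [n1 _] := fel t0 c1.
have [n2 _] := fel t0 (C0_cutoff k nice bphi).
have /cvgrPdist_lt/(_ d d0) m1 := n1 x.
have /cvgrPdist_lt/(_ _ e4) m2 := n2 x.
near=> y.
have h1 : `|semigroup P X t (cutoff k) x - semigroup P X t (cutoff k) y| < d by near: y.
have h2 : `|semigroup P X t (fun z => phi z * cutoff k z) x -
  semigroup P X t (fun z => phi z * cutoff k z) y| < e / 4 by near: y.
have h3 := close k x; have h4 := close k y.
have hx : C * (1 - semigroup P X t (cutoff k) x) <= e / 8.
  have -> : e / 8 = C * d by rewrite /d; field; rewrite gt_eqF.
  by rewrite ler_pM2l// ltW//; apply: le_lt_trans (ler_norm _) hk.
have hy : C * (1 - semigroup P X t (cutoff k) y) <= e / 4.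
  have -> : e / 4 = C * (d + d) by rewrite /d; field; rewrite gt_eqF.
  rewrite ler_pM2l//.
  have := ler_norm (1 - semigroup P X t (cutoff k) x).
  have := ler_norm (semigroup P X t (cutoff k) x - semigroup P X t (cutoff k) y).
  by move: hk h1 => /=; lra.
move: h2 h3 h4 hx hy.
set a := semigroup P X t phi x; set b := semigroup P X t phi y.
set a' := semigroup P X t _ x; set b' := semigroup P X t _ y.
move=> h2 h3 h4 hx hy.
have -> : a - b = (a - a') + (a' - b') - (b - b') by ring.
apply: le_lt_trans (ler_normB _ _) _; apply: le_lt_trans (lerD (ler_normD _ _) (lexx _)) _.
by lra.
Unshelve. all: by end_near. Qed.

Lemma semigroup_rc phi x t : cb phi -> 0 <= t ->
  (fun s => semigroup P X s phi x) @ at_right t --> semigroup P X t phi x.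
Proof.
move=> bphi t0; have [cphi [C hC]] := bphi; apply/cvg_at_rightP => u [tu ut].
have u0 n : 0 <= u n by exact: le_trans t0 (ltW (tu n)).
apply: (@expect_dct _ _ _ _ P x (fun n w => phi (X (u n) w)) _ C).
- by move=> n; exact: (fpath_meas mk).
- by [].
- move=> w; apply: (@at_right_seq _ _ (fun s => phi (X s w)) t u) => //.
    exact: (fpath_rc mk).
  by move=> n; exact: ltW.
Qed.

Lemma kernel_bmeas (rho : Omega -> R) s (B : set borelE) :
  measurable_fun setT rho -> (forall w, 0 <= rho w) -> 0 <= s -> measurable B ->
  bmeas setT (fun w => fine (P (X (rho w) w) (X s @^-1` B))).
Proof.
move=> mrho rho0 s0 mB; split.
  move=> _ D mD; rewrite setTI.
  have mf : measurable_fun [set: borelE] (fun y : borelE => fine (P y (X s @^-1` B))).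
    apply: measurableT_comp (kernel_meas mk s0 mB); exact: fine_measurable.
  have := mf measurableT D mD; rewrite setTI => mD'.
  exact: (sample_borel mk mrho rho0 mD').
exists 1 => w _; have mX := state_meas mk s0 mB.
rewrite ger0_norm ?fine_ge0// -lee_fin fineK ?fin_num_measure//.
exact: probability_le1.
Qed.

Lemma strong_markov_set x rho s (A : set Omega) (B : set borelE) :
  rst F rho -> 0 <= s -> F_at F (fun w => (rho w)%:E) A -> measurable B ->
  expect P x (fun w => \1_A w * \1_B (X (rho w + s) w)) =
  expect P x (fun w => \1_A w * fine (P (X (rho w) w) (X s @^-1` B))).
Proof.
move=> hrho s0 hA mB.
have mrho := rst_meas mk hrho; have rho0 := hrho.1.
have mXs : measurable [set w | B (X (rho w + s) w)].
  apply: (@sample_borel _ _ _ _ _ _ _ mk (fun w => rho w + s)) => //.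
    by apply: measurable_funD => //; exact: measurable_cst.
  by move=> w; rewrite addr_ge0.
have mA := hA.1.
have := mk; rewrite /standard_markov => -[_ [_ [_ [_ [_ [_ [_ [_ [sm _]]]]]]]]].
have Afin : A `<=` [set w | ((rho w)%:E < +oo)%E] by move=> w _; exact: ltry.
have {sm} := sm x _ s ((rst_stopping F rho).1 hrho) s0 A B hA Afin mB.
rewrite /X_at /= => sm.
rewrite (@expect_eq _ _ _ _ P x _ (\1_(A `&` [set w | B (X (rho w + s) w)]))); last first.
  by move=> w; rewrite indicI.
rewrite /expect /Rintegral integral_indic//; last exact: measurableI.
rewrite setIT; apply: (etrans (congr1 fine sm)).
apply: (congr1 fine); rewrite [LHS]integral_mkcond; apply: eq_integral => w _.
rewrite patchE indicE; case: (w \in A); rewrite ?mul0r// mul1r fineK// fin_num_measure//.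
exact: (state_meas mk).
Qed.

End Semigroup.

(** * One step of dynamic programming *)

Lemma riemann_bound {R : realType} (phi : R -> R) (C h : R) (k : nat) (t : nat -> R) : 0 < h ->
  (forall i, `|phi (t i)| <= C) ->
  `|\sum_(0 <= i < k.+1) (h / k.+1%:R) * phi (t i)| <= C * h.
Proof.
move=> h0 hC; apply: le_trans (ler_norm_sum _ _ _) _.
have -> : C * h = \sum_(0 <= i < k.+1) (h / k.+1%:R) * C.
  by rewrite sumr_const_nat subn0 -[RHS]mulr_natr mulrAC divfK ?pnatr_eq0// mulrC.
apply: ler_sum => i _; rewrite normrM gtr0_norm ?divr_gt0//.
by rewrite ler_wpM2l// divr_ge0// ltW.
Qed.

(** The indicators turn a sum with a random number [k] of terms into one over a fixed range, on
    which expectation acts term by term. *)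
Lemma telescope_upto {R : realType} (a : nat -> R) (k N : nat) : (k <= N)%N ->
  \sum_(0 <= j < N) (j < k)%N%:R * (a j.+1 - a j) = a k - a 0%N.
Proof.
move=> kN; rewrite (big_cat_nat _ kN)//= [X in _ + X]big1_seq ?addr0; last first.
  by move=> j; rewrite mem_index_iota => /andP[_ /andP[kj _]]; rewrite ltnNge kj mul0r.
rewrite -telescope_sumr//; apply: eq_big_nat => j /andP[_ jk].
by rewrite jk mul1r.
Qed.

Section Dynamic.
Context {R : realType} {E : pmetricType R} {dO : measure_display}
  {Omega : measurableType dO}.
Variables (P : E -> probability Omega R) (X : R -> Omega -> E)
  (F : R -> set (set Omega)) (f : E -> R).
Notation borelE := (g_sigma_algebraType (@open E)).
Hypothesis nice : nice_space E.
Hypothesis mk : standard_markov P X F.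
Hypothesis fel : weak_feller P X.
Hypothesis cf : cb f.
Notation Ex := (expect P).
Notation Pt := (semigroup P X).

Lemma sample_indic (rho : Omega -> R) (B : set borelE) :
  measurable_fun setT rho -> (forall w, 0 <= rho w) -> measurable B ->
  bmeas setT (fun w => \1_B (X (rho w) w) : R).
Proof.
move=> mrho rho0 mB.
rewrite (_ : (fun w => _) = \1_[set w | B (X (rho w) w)]).
  by apply: bmeas_indic; exact: (sample_borel mk).
by apply/funext => w; rewrite !indicE; congr (_%:R); apply/idP/idP; rewrite !inE.
Qed.

(* The set version extends to bounded continuous functions because a function
   with values in [0, 2C] is within e of a staircase in its superlevel sets. *)
Lemma strong_markov x rho s (A : set Omega) phi :
  rst F rho -> 0 <= s -> F_at F (fun w => (rho w)%:E) A -> cb phi ->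
  Ex x (fun w => \1_A w * phi (X (rho w + s) w)) =
  Ex x (fun w => \1_A w * Pt s phi (X (rho w) w)).
Proof.
move=> hrho s0 hA bphi; have [cphi [K hK]] := bphi.
pose C := `|K| + 1; have Cp : 0 < C by rewrite ltr_wpDl.
have hC y : `|phi y| <= C.
  by apply: le_trans (hK y) _; apply: le_trans (ler_norm _) _; rewrite lerDl.
have mrho := rst_meas mk hrho; have rho0 := hrho.1; have mA := hA.1.
have rs0 w : 0 <= rho w + s by rewrite addr_ge0.
have mrs : measurable_fun setT (fun w => rho w + s).
  by apply: measurable_funD => //; exact: measurable_cst.
have bA : bmeas setT (\1_A : Omega -> R) by exact: bmeas_indic.
have b1 := sample_bmeas mk bphi mrs rs0.
have b2 := sample_bmeas mk (semigroup_cb nice mk fel s0 bphi) mrho rho0.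
apply/eqP; rewrite -subr_eq0 -normr_le0.
apply: (@le_eps_inv _ _ (4 * C)); first by rewrite mulr_ge0// ltW.
(* The range [0, 2C] of [phi + C] is cut into [n + 1] levels of height [e]. Each side of the
   identity is approximated within [e], whence the bound 4C/(n+1). *)
move=> n; pose e := 2 * C / n.+1%:R; have e0 : 0 < e by rewrite divr_gt0// mulr_gt0.
pose B i : set borelE := [set y | i.+1%:R * e - C <= phi y].
have mB i : measurable (B i) by exact: borel_ge.
pose psi y := \sum_(0 <= i < n.+1) e * \1_(B i) y - C.
have hpsi y : `|phi y - psi y| <= e.
  have := hC y; rewrite ler_norml => /andP[c1 c2].
  have v0 : 0 <= phi y + C by lra.
  have vn : phi y + C <= n.+1%:R * e.
    rewrite /e mulrCA mulfV ?mulr1//; lra.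
  have := stairP e0 v0 vn.
  have -> : stair n.+1 e (phi y + C) = psi y + C.
    rewrite /psi subrK; apply: eq_bigr => i _; congr (_ * _).
    rewrite indicE; congr ((nat_of_bool _)%:R).
    by apply/idP/idP; rewrite inE /B /= lerBlDr.
  by move=> /andP[h1 h2]; rewrite ler_norml; apply/andP; split; lra.
have bp (r : Omega -> R) (mr : measurable_fun setT r) (r0 : forall w, 0 <= r w) :
    bmeas setT (fun w => psi (X (r w) w)).
  apply: bmeasB; last exact: bmeas_cst.
  by apply: bmeas_sum => i; apply: bmeasZ; exact: sample_indic.
(* [q] is the expectation of [psi (X s)] started at [y], written through kernels because this is the
   form that the Markov property for sets produces. *)
pose q y := \sum_(0 <= i < n.+1) e * fine (P y (X s @^-1` (B i))) - C.
have bq : bmeas setT (fun w => q (X (rho w) w)).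
  apply: bmeasB; last exact: bmeas_cst.
  by apply: bmeas_sum => i; apply: bmeasZ; exact: (kernel_bmeas mk).
have qE y : q y = Ex y (fun w => psi (X s w)).
  have bi i : bmeas setT (fun w => \1_(B i) (X s w) : R).
    exact: (@sample_indic (fun=> s)).
  rewrite expectB; last exact: bmeas_cst.
    rewrite expect_cst expect_sum => [|i]; last exact: bmeasZ.
    congr (_ - _); apply: eq_bigr => i _; rewrite expectZ//; congr (_ * _).
    have mXB := state_meas mk s0 (mB i).
    rewrite (@expect_eq _ _ _ _ P y _ (\1_(X s @^-1` B i))) => [|w]; last first.
      by rewrite !indicE; congr (_%:R); apply/idP/idP; rewrite !inE.
    by rewrite /expect /Rintegral integral_indic// setIT.
  by apply: bmeas_sum => i; exact: bmeasZ.
have hq y : `|Pt s phi y - q y| <= e.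
  rewrite qE; apply: (@expect_dist _ _ _ _ P y (fun w => phi (X s w))) => //.
    exact: (cb_path mk).
  exact: (bp (fun=> s)).
have main : Ex x (fun w => \1_A w * psi (X (rho w + s) w)) =
    Ex x (fun w => \1_A w * q (X (rho w) w)).
  have split (u : nat -> Omega -> R) : (forall i, bmeas setT (u i)) ->
      Ex x (fun w => \1_A w * (\sum_(0 <= i < n.+1) e * u i w - C)) =
      \sum_(0 <= i < n.+1) e * Ex x (fun w => \1_A w * u i w) - C * Ex x (\1_A).
    move=> bu; have bAu i : bmeas setT (fun w => \1_A w * u i w) by exact: bmeasM.
    rewrite -(expectZ P x C bA).
    rewrite -(eq_bigr _ (fun i _ => expectZ P x e (bAu i))) -expect_sum; last first.
      by move=> i; exact: bmeasZ.
    rewrite -expectB.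
    - apply: expect_eq => w; rewrite mulrBr mulr_sumr [C * _]mulrC; congr (_ - _).
      by apply: eq_bigr => i _; rewrite mulrCA.
    - by apply: bmeas_sum => i; exact: bmeasZ.
    - exact: bmeasZ.
  rewrite (split (fun i w => \1_(B i) (X (rho w + s) w))); last by move=> i; exact: sample_indic.
  rewrite (split (fun i w => fine (P (X (rho w) w) (X s @^-1` (B i))))); last first.
    by move=> i; exact: (kernel_bmeas mk).
  congr (_ - _); apply: eq_bigr => i _; congr (_ * _).
  exact: (strong_markov_set mk).
have ind1 (a c : R) w : `|a - c| <= e -> `|\1_A w * a - \1_A w * c| <= e.
  move=> h; rewrite -mulrBr indicE; case: (w \in A); first by rewrite mul1r.
  by rewrite mul0r normr0 ltW.
have d1 : `|Ex x (fun w => \1_A w * phi (X (rho w + s) w)) -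
    Ex x (fun w => \1_A w * psi (X (rho w + s) w))| <= e.
  apply: expect_dist; [exact: bmeasM|by apply: bmeasM => //; exact: bp|].
  by move=> w; exact: ind1.
have d2 : `|Ex x (fun w => \1_A w * Pt s phi (X (rho w) w)) -
    Ex x (fun w => \1_A w * q (X (rho w) w))| <= e.
  by apply: expect_dist; [exact: bmeasM|exact: bmeasM|move=> w; exact: ind1].
have -> : 4 * C / n.+1%:R = e + e by rewrite /e -mulrDl; congr (_ / _); ring.
move: d1 d2; rewrite main; set a := Ex x _; set b := Ex x _; set c := Ex x _.
move=> d1 d2; have -> : a - c = (a - b) - (c - b) by ring.
by apply: le_trans (ler_normB _ _) _; exact: lerD.
Qed.

Definition Ipath (t : R) (w : Omega) : R := timeint (fun s => f (X s w)) t.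

(** The expected running reward over one step, with the time integral outside: in this order
    continuity in [x] is inherited from each [P_s f]. [onestep_int] justifies the order. *)
Definition Fint (h : R) (x : E) : R := timeint (fun s => Pt s f x) h.

(** Measurability in the sample point comes from Riemann sums, so joint measurability in time and
    sample point is not called upon. *)
Lemma Ipath_meas_fixed t : 0 <= t -> measurable_fun setT (Ipath t).
Proof.
have [cf' [C hC]] := cf; rewrite le_eqVlt => /predU1P[<-|t0].
  rewrite (_ : Ipath 0 = fun=> 0); first exact: measurable_cst.
  by apply/funext => w; rewrite /Ipath timeint0.
apply: (@measurable_fun_cvg _ _ _ _ (fun k w => \sum_(0 <= i < k.+1)
    (t / k.+1%:R) * f (X (0 + i.+1%:R * (t / k.+1%:R)) w))).
  move=> k; have b i : bmeas setT (fun w => (t / k.+1%:R) * f (X (0 + i.+1%:R * (t / k.+1%:R)) w)).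
    by apply/bmeasZ/(cb_path mk) => //; rewrite add0r mulr_ge0// divr_ge0// ltW.
  by have [] := bmeas_sum (index_iota 0 k.+1) b.
move=> w _; have := @riemann_sum R (fun s => f (X s w)) C _ _ 0 t (lexx _) t0.
rewrite add0r timeint0 subr0; apply => //.
by move=> s s0; exact: (fpath_rc mk).
Qed.

Lemma Ipath_rc w t : 0 <= t -> Ipath ^~ w @ at_right t --> Ipath t w.
Proof.
have [cf' [C hC]] := cf; move=> t0; apply: (@timeint_rc _ _ C) => //.
by move=> s s0; exact: (fpath_rc mk).
Qed.

Lemma Ipath_meas (rho : Omega -> R) : measurable_fun setT rho -> (forall w, 0 <= rho w) ->
  measurable_fun setT (fun w => Ipath (rho w) w).
Proof.
move=> mrho rho0; apply: measurable_sample => //.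
- by move=> t; exact: Ipath_meas_fixed.
- by move=> w t; exact: Ipath_rc.
Qed.

Lemma Ipath_bound C w t : (forall y, `|f y| <= C) -> 0 <= t -> `|Ipath t w| <= C * t.
Proof.
move=> hC; apply: timeint_bound => // s s0; apply: (fpath_rc mk) => //.
by case: cf.
Qed.

Lemma Ipath_dist C w s t : (forall y, `|f y| <= C) -> 0 <= s -> 0 <= t ->
  `|Ipath s w - Ipath t w| <= C * `|s - t|.
Proof.
move=> hC s0 t0; apply: timeint_dist => // r r0; apply: (fpath_rc mk) => //.
by case: cf.
Qed.

Lemma Ipath_bmeas (rho : Omega -> R) (T : R) :
  measurable_fun setT rho -> (forall w, 0 <= rho w) -> (forall w, rho w <= T) ->
  bmeas setT (fun w => Ipath (rho w) w).
Proof.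
move=> mrho rho0 rhoT; split; first exact: Ipath_meas.
have [cf' [C hC]] := cf; exists (C * T) => w _; apply: le_trans (Ipath_bound _ hC (rho0 w)) _.
by rewrite ler_wpM2l//; exact: le_trans (normr_ge0 _) (hC point).
Qed.

Lemma Fint_cb h : 0 <= h -> cb (Fint h).
Proof.
have [cf' [C hC]] := cf; move=> h0.
have rc x s : 0 <= s -> (fun r => Pt r f x) @ at_right s --> Pt s f x.
  exact: (semigroup_rc mk).
have bd x s : 0 <= s -> `|Pt s f x| <= C by move=> s0; exact: (semigroup_bound mk).
split; last by exists (C * h) => x; exact: (@timeint_bound _ (fun s => Pt s f x) C (rc x) (bd x)).
apply: seq_continuous => u x ux.
apply: (@bmeasR_dct _ _ _ _ (@lebesgue_measure R) _ _ (fun n s => Pt s f (u n)) _ C) => //.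
- exact: leb_itv_lty.
- by move=> n; apply: measurable_rc_itv => //; exact: rc.
- by move=> n s /=; rewrite in_itv/= => /andP[s0 _]; exact: bd.
- move=> s /=; rewrite in_itv/= => /andP[s0 _].
  have [cs _] := semigroup_cb nice mk fel s0 cf.
  exact: continuous_cvg (cs x) ux.
Qed.

(** The value of running for exactly [h] and then receiving [phi]; see [Q_rep]. *)
Definition Qop (h : R) (phi : E -> R) (x : E) : R := Fint h x + Pt h phi x.

Lemma cbD (phi psi : E -> R) : cb phi -> cb psi -> cb (fun y => phi y + psi y).
Proof.
move=> [c1 [C1 h1]] [c2 [C2 h2]]; split; first by move=> y; apply: continuousD; [exact: c1|exact: c2].
by exists (C1 + C2) => y; apply: le_trans (ler_normD _ _) _; exact: lerD.
Qed.

Lemma Qop_cb h phi : 0 <= h -> cb phi -> cb (Qop h phi).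
Proof. by move=> h0 bphi; apply: cbD; [exact: Fint_cb|exact: (semigroup_cb nice mk fel)]. Qed.

Lemma Qop_le h phi psi x : 0 <= h -> cb phi -> cb psi -> (forall y, phi y <= psi y) ->
  Qop h phi x <= Qop h psi x.
Proof. by move=> h0 b1 b2 le; rewrite lerD2l; exact: (semigroup_le mk). Qed.

(** Both sides are limits of Riemann sums, those on the left along the path after [rho] and those on
    the right in the semigroup. The strong Markov property equates the sums term by term. *)
Lemma onestep_int x rho (T : R) (A : set Omega) h : rst F rho -> (forall w, rho w <= T) ->
  F_at F (fun w => (rho w)%:E) A -> 0 < h ->
  Ex x (fun w => \1_A w * (Ipath (rho w + h) w - Ipath (rho w) w)) =
  Ex x (fun w => \1_A w * Fint h (X (rho w) w)).
Proof.
move=> hrho rhoT hA h0; have [cf' [C hC]] := cf.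
have mrho := rst_meas mk hrho; have rho0 := hrho.1; have mA := hA.1.
have bA : bmeas setT (\1_A : Omega -> R) by exact: bmeas_indic.
have indb w (a K : R) : `|a| <= K -> `|\1_A w * a| <= K.
  move=> aK; rewrite indicE; case: (w \in A); first by rewrite mul1r.
  by rewrite mul0r normr0; exact: le_trans (normr_ge0 _) aK.
pose e k : R := h / k.+1%:R; have e0 k : 0 <= e k by rewrite divr_ge0// ltW.
have ie0 k (i : nat) : 0 <= i.+1%:R * e k by rewrite mulr_ge0.
pose Y k w := \1_A w * \sum_(0 <= i < k.+1) e k * f (X (rho w + i.+1%:R * e k) w).
(* The leading 0 matches [riemann_sum] at starting time 0. *)
pose Z k w := \1_A w * \sum_(0 <= i < k.+1) e k * Pt (0 + i.+1%:R * e k) f (X (rho w) w).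
have bY1 k i : bmeas setT (fun w => f (X (rho w + i.+1%:R * e k) w)).
  apply: (@sample_bmeas _ _ _ _ _ _ _ mk f (fun w => rho w + i.+1%:R * e k)) => //.
    by apply: measurable_funD => //; exact: measurable_cst.
  by move=> w; rewrite addr_ge0.
have bZ1 k i : bmeas setT (fun w => Pt (0 + i.+1%:R * e k) f (X (rho w) w)).
  by apply: (sample_bmeas mk) => //; apply: (semigroup_cb nice mk fel) => //; rewrite add0r.
have YZ k : Ex x (Y k) = Ex x (Z k).
  have split (u : nat -> Omega -> R) : (forall i, bmeas setT (u i)) ->
      Ex x (fun w => \1_A w * \sum_(0 <= i < k.+1) e k * u i w) =
      \sum_(0 <= i < k.+1) e k * Ex x (fun w => \1_A w * u i w).
    move=> bu; have bAu i : bmeas setT (fun w => \1_A w * u i w) by exact: bmeasM.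
    rewrite -(eq_bigr _ (fun i _ => expectZ P x (e k) (bAu i))) -expect_sum; last first.
      by move=> i; exact: bmeasZ.
    apply: expect_eq => w; rewrite mulr_sumr.
    by apply: eq_bigr => i _; rewrite mulrCA.
  rewrite /Y /Z (split (fun i w => f (X (rho w + i.+1%:R * e k) w)))//.
  rewrite (split (fun i w => Pt (0 + i.+1%:R * e k) f (X (rho w) w)))//.
  apply: eq_bigr => i _; congr (_ * _); rewrite add0r; exact: strong_markov.
have cY : (fun k => Ex x (Y k)) @ \oo -->
    Ex x (fun w => \1_A w * (Ipath (rho w + h) w - Ipath (rho w) w)).
  apply: (@expect_dct _ _ _ _ P x Y _ (C * h)).
  - move=> k; have [] // : bmeas setT (Y k).
    by apply: bmeasM => //; apply: bmeas_sum => i; exact: bmeasZ.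
  - move=> k w; apply: indb.
    exact: (@riemann_bound _ (fun s => f (X s w)) C h k (fun i => rho w + i.+1%:R * e k)).
  - move=> w; apply: cvgM; first exact: cvg_cst.
    apply: (@riemann_sum R (fun s => f (X s w)) C) => //.
    by move=> s s0; exact: (fpath_rc mk).
have cZ : (fun k => Ex x (Z k)) @ \oo --> Ex x (fun w => \1_A w * Fint h (X (rho w) w)).
  have bd y s : 0 <= s -> `|Pt s f y| <= C by move=> s0; exact: (semigroup_bound mk).
  apply: (@expect_dct _ _ _ _ P x Z _ (C * h)).
  - move=> k; have [] // : bmeas setT (Z k).
    by apply: bmeasM => //; apply: bmeas_sum => i; exact: bmeasZ.
  - move=> k w; apply: indb.
    apply: (@riemann_bound _ (fun s => Pt s f (X (rho w) w)) C h k (fun i => 0 + i.+1%:R * e k)) => //.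
    by move=> i; apply: bd; rewrite add0r.
  - move=> w; apply: cvgM; first exact: cvg_cst.
    have := @riemann_sum R (fun s => Pt s f (X (rho w) w)) C _ _ 0 h (lexx _) h0.
    rewrite [X in _ --> X - _](_ : _ = Fint h (X (rho w) w)) ?add0r// timeint0 subr0; apply.
      by move=> s s0; exact: (semigroup_rc mk).
    by move=> s s0; exact: bd.
apply: (@cvg_unique _ _ _ _ _ _ cY) => //.
by move: cZ; apply: cvg_trans; apply: near_eq_cvg; apply: nearW => k; rewrite YZ.
Qed.

(** In the applications [A] is the event that one more grid step is taken, which is decided at time
    [rho]. *)
Lemma onestep x rho (T : R) (A : set Omega) h phi : rst F rho -> (forall w, rho w <= T) ->
  F_at F (fun w => (rho w)%:E) A -> 0 < h -> cb phi ->
  Ex x (fun w => \1_A w * (Ipath (rho w + h) w - Ipath (rho w) w + phi (X (rho w + h) w))) =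
  Ex x (fun w => \1_A w * Qop h phi (X (rho w) w)).
Proof.
move=> hrho rhoT hA h0 bphi.
have mrho := rst_meas mk hrho; have rho0 := hrho.1; have mA := hA.1.
have bA : bmeas setT (\1_A : Omega -> R) by exact: bmeas_indic.
have mrh : measurable_fun setT (fun w => rho w + h).
  by apply: measurable_funD => //; exact: measurable_cst.
have rh0 w : 0 <= rho w + h by rewrite addr_ge0// ltW.
have b1 : bmeas setT (fun w => Ipath (rho w + h) w - Ipath (rho w) w).
  apply: bmeasB; last exact: Ipath_bmeas rhoT.
  by apply: (@Ipath_bmeas _ (T + h)) => // w; rewrite lerD2r.
have b2 := sample_bmeas mk bphi mrh rh0.
have b3 := sample_bmeas mk (Fint_cb (ltW h0)) mrho rho0.
have b4 := sample_bmeas mk (semigroup_cb nice mk fel (ltW h0) bphi) mrho rho0.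
rewrite (@expect_eq _ _ _ _ P x _ (fun w => \1_A w * (Ipath (rho w + h) w - Ipath (rho w) w) +
  \1_A w * phi (X (rho w + h) w))) => [|w]; last by rewrite mulrDr.
rewrite expectD; [|exact: bmeasM|exact: bmeasM].
rewrite (onestep_int x hrho rhoT hA h0) (strong_markov x hrho (ltW h0) hA bphi).
rewrite -expectD; [|exact: bmeasM|exact: bmeasM].
by apply: expect_eq => w; rewrite mulrDr.
Qed.

End Dynamic.

(** * Dynamic programming on a grid *)

Definition ceiln {R : realType} (r : R) : nat := `|Num.ceil r|%N.

Lemma ceiln_gt {R : realType} (r : R) (j : nat) : 0 <= r -> (j < ceiln r)%N = (j%:R < r).
Proof.
move=> r0; have c0 : 0 <= Num.ceil r by rewrite ceil_ge0; lra.
by rewrite /ceiln -ltz_nat gez0_abs// ceil_gt_int -pmulrn.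
Qed.

Lemma ceiln_bounds {R : realType} (r : R) : 0 <= r -> r <= (ceiln r)%:R <= r + 1.
Proof.
move=> r0; apply/andP; split; first by rewrite leNgt -ceiln_gt// ltnn.
case E : (ceiln r) => [|k]; first by rewrite addr_ge0.
by rewrite -natr1 lerD2r ltW// -ceiln_gt// E.
Qed.

Lemma lerD_exchange {R : realType} (a b c e r y : R) :
  a + b <= c + e -> r <= b - e + y -> a + r <= c + y.
Proof. by move=> *; lra. Qed.

Section DynamicProgramming.
Context {R : realType} {E : pmetricType R} {dO : measure_display}
  {Omega : measurableType dO}.
Variables (P : E -> probability Omega R) (X : R -> Omega -> E)
  (F : R -> set (set Omega)) (f g : E -> R).
Notation borelE := (g_sigma_algebraType (@open E)).
Hypothesis nice : nice_space E.
Hypothesis mk : standard_markov P X F.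
Hypothesis fel : weak_feller P X.
Hypothesis (cf : cb f) (cg : cb g).
Notation Ex := (expect P).
Notation Pt := (semigroup P X).
Notation I_ := (Ipath X f).
Notation Q := (Qop P X f).

Lemma rst_cst c : 0 <= c -> rst F (fun=> c).
Proof. by move=> c0; split=> // t t0; exact: (salg_const (filt_salg mk t0)). Qed.

Lemma F_at_cst c A : 0 <= c -> F c A -> F_at F (fun=> c%:E) A.
Proof.
move=> c0 FA; split; first exact: (filt_meas mk c0).
move=> t t0; have sG := filt_salg mk t0; case: (leP c t) => ct; last first.
  rewrite (_ : _ `&` _ = set0); first exact: salg0.
  by apply/seteqP; split => // w [_ /=]; rewrite lee_fin leNgt ct.
apply: (salgI sG); last exact: (salg_const sG). exact: (filt_mono mk c0 ct FA).
Qed.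

Lemma F_at_setT c : 0 <= c -> F_at F (fun=> c%:E) setT.
Proof. by move=> c0; apply: F_at_cst => //; exact: (salgT (filt_salg mk c0)). Qed.

Lemma rst_addc rho c : rst F rho -> 0 <= c -> rst F (fun w => rho w + c).
Proof.
move=> [r0 hr] c0; split; first by move=> w; rewrite addr_ge0.
move=> t t0; case: (leP c t) => ct.
  rewrite (_ : [set w | _] = [set w | rho w <= t - c]).
    by apply: (filt_mono mk _ _ (hr _ _)); rewrite ?subr_ge0// lerBlDr lerDl.
  by apply/seteqP; split => w /=; rewrite lerBrDr.
rewrite (_ : [set w | _] = set0); first exact: (salg0 (filt_salg mk t0)).
apply/seteqP; split => // w /= h.
by have := lt_le_trans ct (le_trans _ h); rewrite ltxx lerDr r0 => /(_ isT).
Qed.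

(** On {rho <= t}, the inequality holds iff sigma exceeds [t] or a rational [q <= t] separates rho
    from sigma; both alternatives are known at time [t]. *)
Lemma F_at_lt rho sigma : rst F rho -> rst F sigma ->
  F_at F (fun w => (rho w)%:E) [set w | rho w < sigma w].
Proof.
move=> hr hs; split; first by apply: measurable_set_lt; exact: (rst_meas mk).
move=> t t0; have sG := filt_salg mk t0.
rewrite (_ : _ `&` _ =
  (\bigcup_(q in [set q : rat | 0 <= ratr q :> R /\ (ratr q : R) <= t])
      ([set w | rho w <= ratr q] `\` [set w | sigma w <= ratr q])) `|`
  ([set w | rho w <= t] `\` [set w | sigma w <= t])).
  apply: salgU => //; last by apply: salgD => //; [exact: hr.2|exact: hs.2].
  apply: salg_bigcup_rat => // q [q0 qt]; apply: salgD => //.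
    by apply: (filt_mono mk q0 qt); exact: hr.2.
  by apply: (filt_mono mk q0 qt); exact: hs.2.
apply/seteqP; split => w /=.
  move=> [h]; rewrite lee_fin => ht; case: (ltP t (sigma w)) => st.
    by right; split => //; apply/negP; rewrite -ltNge.
  left; have [q] := rat_in_itvoo h; rewrite in_itv/= => /andP[q1 q2].
  exists q; last by split; [exact: ltW|apply/negP; rewrite -ltNge].
  split; first exact: le_trans (hr.1 w) (ltW q1).
  exact: le_trans (ltW q2) st.
case=> [[q [q0 qt] [h1 /negP]]|[h1 /negP]]; rewrite -ltNge => h2.
  by split; [exact: le_lt_trans h1 h2|rewrite lee_fin; exact: le_trans h1 qt].
by split; [exact: le_lt_trans h1 h2|rewrite lee_fin].
Qed.

Lemma start_null x : measurable (~` [set w | X 0 w = x]) /\ P x (~` [set w | X 0 w = x]) = 0%E.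
Proof.
have m1 : measurable ([set x] : set borelE).
  rewrite -[X in measurable X]setCK; apply: measurableC; apply: sub_sigma_algebra.
  apply: closed_openC; apply: accessible_closed_set1.
  exact/hausdorff_accessible/metric_hausdorff.
have m0 : measurable [set w | X 0 w = x] := state_meas mk (lexx 0) m1.
split; first exact: measurableC.
have h := probability_setC (P x) m0; apply: (etrans h).
by have := start mk x => ->; rewrite subee.
Qed.

Lemma expect_start x phi : cb phi -> Ex x (fun w => phi (X 0 w)) = phi x.
Proof.
move=> bphi; have [mN N0] := start_null x.
have b := cb_path mk (lexx 0) bphi.
rewrite -[RHS](expect_cst P x).
apply/eqP; rewrite eq_le; apply/andP; split.
all: apply: (bmeasR_le_ae _ (Plty P x) mN N0) => //; [exact: bmeas_cst| ].
all: by move=> w _ /contrapT ->.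
Qed.

Lemma Q_rep x h phi : 0 < h -> cb phi -> Q h phi x = Ex x (fun w => I_ h w + phi (X h w)).
Proof.
move=> h0 bphi.
rewrite -(expect_start x (Qop_cb nice mk fel cf (ltW h0) bphi)).
have := onestep nice mk fel cf x (rst_cst (lexx 0)) (fun=> lexx 0) (F_at_setT (lexx 0)) h0 bphi.
rewrite (@expect_eq _ _ _ _ P x _ (fun w => I_ h w + phi (X h w))) => [->|w].
  by apply: expect_eq => w; rewrite indicT mul1r.
by rewrite indicT mul1r add0r /Ipath timeint0 subr0.
Qed.

(** The semigroup law for [Q], obtained from the one-step identity at the deterministic time
    [h / 2]. *)
Lemma Q_half x h phi : 0 < h -> cb phi -> Q (h / 2) (Q (h / 2) phi) x = Q h phi x.
Proof.
move=> h0 bphi; have h2 : 0 < h / 2 by rewrite divr_gt0.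
have bQ := Qop_cb nice mk fel cf (ltW h2) bphi.
rewrite !Q_rep//.
have := onestep nice mk fel cf x (rst_cst (ltW h2)) (fun=> lexx (h / 2)) (F_at_setT (ltW h2)) h2 bphi.
have bI t : 0 <= t -> bmeas setT (I_ t).
  by move=> t0; exact: (@Ipath_bmeas _ _ _ _ _ _ _ _ mk cf (fun=> t) t).
have bI2 := bI _ (ltW h2); have bIh := bI _ (ltW h0).
have bp := cb_path mk (ltW h0) bphi; have bq := cb_path mk (ltW h2) bQ.
rewrite (expectD P x bI2 bq).
rewrite (@expect_eq _ _ _ _ P x _ (fun w => I_ h w - I_ (h / 2) w + phi (X h w))); last first.
  by move=> w; rewrite indicT mul1r -splitr.
rewrite (@expect_eq _ _ _ _ P x (fun w => _ * Q _ _ _) (fun w => Q (h / 2) phi (X (h / 2) w))); last first.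
  by move=> w; rewrite indicT mul1r.
move=> <-; rewrite -expectD//; last by apply: bmeasD => //; exact: bmeasB.
by apply: expect_eq => w; rewrite addrA subrKC.
Qed.

(** The index counts the steps that remain, so at step [j] of a problem with [N] steps the value in
    force is [dv h (N - j)]. *)
Fixpoint dv (h : R) (k : nat) : E -> R :=
  if k is k'.+1 then fun y => Num.max (g y) (Q h (dv h k') y) else g.

Lemma cb_max (phi psi : E -> R) : cb phi -> cb psi -> cb (fun y => Num.max (phi y) (psi y)).
Proof.
move=> [c1 [C1 h1]] [c2 [C2 h2]]; split; first exact: continuous_maxr.
exists (`|C1| + `|C2|) => y.
have a1 := le_trans (h1 y) (ler_norm _); have a2 := le_trans (h2 y) (ler_norm _).
have n1 := normr_ge0 C1; have n2 := normr_ge0 C2.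
by case: (leP (phi y) (psi y)) => _; lra.
Qed.

Lemma dv_cb h k : 0 < h -> cb (dv h k).
Proof.
move=> h0; elim: k => [//|k IH]; apply: cb_max => //.
exact: (Qop_cb nice mk fel cf (ltW h0) IH).
Qed.

Lemma dv_ge_g h k y : g y <= dv h k y.
Proof. by case: k => [//|k] /=; rewrite le_max lexx. Qed.

Lemma dv_leS h k y : 0 < h -> dv h k y <= dv h k.+1 y.
Proof.
move=> h0; elim: k y => [|k IH] y; first exact: dv_ge_g.
rewrite /= ge_max le_max lexx/= le_max; apply/orP; right.
by apply: (Qop_le f mk) => //; [exact: ltW|exact: dv_cb|exact: (dv_cb k.+1)].
Qed.

Lemma dv_le h k l y : 0 < h -> (k <= l)%N -> dv h k y <= dv h l y.
Proof.
move=> h0; elim: l => [|l IH]; first by rewrite leqn0 => /eqP ->.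
rewrite leq_eqVlt => /predU1P[->//|]; rewrite ltnS => /IH kl.
exact: le_trans kl (dv_leS _ _ h0).
Qed.

(** Halving the mesh keeps the horizon and adds a stopping opportunity inside each old step. *)
Lemma dv_half h k y : 0 < h -> dv h k y <= dv (h / 2) (2 * k) y.
Proof.
move=> h0; have h2 : 0 < h / 2 by rewrite divr_gt0.
elim: k y => [|k IH] y; first by rewrite muln0.
rewrite mulnS /= ge_max le_max lexx/= le_max; apply/orP; right.
rewrite -Q_half//; last exact: dv_cb.
apply: (Qop_le f mk _ (ltW h2)).
- exact/(Qop_cb nice mk fel cf (ltW h2))/dv_cb.
- exact: (dv_cb (2 * k).+1).
- move=> z /=; rewrite le_max; apply/orP; right.
  by apply: (Qop_le f mk _ (ltW h2)) => //; exact: dv_cb.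
Qed.

(** * Drift of the grid values along a random number [kappa] of steps after [rho] *)

Section Drift.
Variables (x : E) (rho : Omega -> R) (T h : R) (kappa : Omega -> nat) (N : nat).
Hypotheses (hrho : rst F rho) (rhoT : forall w, rho w <= T) (h0 : 0 < h).
Hypothesis kN : forall w, (kappa w <= N)%N.
Hypothesis Fk : forall j : nat,
  F_at F (fun w => (rho w + j%:R * h)%:E) [set w | (j < kappa w)%N].

Lemma kappa_meas : measurable_fun setT (fun w => (kappa w)%:R : R).
Proof.
rewrite (_ : (fun w => _) = fun w => \sum_(0 <= j < N) \1_[set w | (j < kappa w)%N] w).
  have b i : bmeas setT (\1_[set w | (i < kappa w)%N] : Omega -> R).
    by apply: bmeas_indic; exact: (Fk i).1.
  by have [] := bmeas_sum (index_iota 0 N) b.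
apply/funext => w; have := @telescope_upto R (fun j => j%:R) _ _ (kN w).
rewrite subr0 => <-; apply: eq_bigr => j _.
rewrite -natr1 addrAC subrr add0r mulr1 indicE; congr ((nat_of_bool _)%:R).
by apply/idP/idP; rewrite inE.
Qed.

Lemma kappa_time_meas : measurable_fun setT (fun w => rho w + (kappa w)%:R * h).
Proof.
apply: measurable_funD; first exact: (rst_meas mk).
by apply: measurable_funM; [exact: kappa_meas|exact: measurable_cst].
Qed.

Lemma kappa_time_ge0 w : 0 <= rho w + (kappa w)%:R * h.
Proof. by rewrite addr_ge0 ?hrho.1// mulr_ge0// ltW. Qed.

Lemma kappa_time_le w : rho w + (kappa w)%:R * h <= T + N%:R * h.
Proof. by rewrite lerD// ler_pM2r// ler_nat. Qed.

Lemma drift_step_bmeas j : bmeas setT (fun w => I_ (rho w + j%:R * h) w) /\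
  forall phi, cb phi -> bmeas setT (fun w => phi (X (rho w + j%:R * h) w)).
Proof.
have mr : measurable_fun setT (fun w => rho w + j%:R * h).
  by apply: measurable_funD; [exact: (rst_meas mk)|exact: measurable_cst].
have r0 w : 0 <= rho w + j%:R * h by rewrite addr_ge0 ?hrho.1// mulr_ge0// ltW.
split; last by move=> phi bphi; exact: (sample_bmeas mk bphi mr r0).
apply: (@Ipath_bmeas _ _ _ _ _ _ _ _ mk cf _ (T + j%:R * h) mr r0) => w.
by rewrite lerD2r.
Qed.

(** Both the index and the time depend on [kappa]; telescoping rewrites the value as a finite sum
    with fixed indices, each term measurable. *)
Lemma dv_sample_bmeas : bmeas setT (fun w => dv h (N - kappa w) (X (rho w + (kappa w)%:R * h) w)).
Proof.
rewrite (_ : (fun w => _) = fun w => dv h N (X (rho w + 0%:R * h) w) +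
  \sum_(0 <= j < N) \1_[set w | (j < kappa w)%N] w *
   (dv h (N - j.+1) (X (rho w + j.+1%:R * h) w) - dv h (N - j) (X (rho w + j%:R * h) w))).
  apply: bmeasD; first exact/(drift_step_bmeas 0).2/dv_cb.
  apply: bmeas_sum => j; apply: bmeasM; first by apply: bmeas_indic; exact: (Fk j).1.
  by apply: bmeasB; [exact/(drift_step_bmeas _.+1).2/dv_cb|exact/(drift_step_bmeas _).2/dv_cb].
apply/funext => w.
pose a j := dv h (N - j) (X (rho w + j%:R * h) w).
rewrite -[LHS]/(a (kappa w)) -[LHS](subrK (a 0%N)) -(telescope_upto a (kN w)) addrC.
congr (_ + _); first by rewrite /a subn0.
apply: eq_bigr => j _; congr (_ * _); rewrite indicE; congr ((nat_of_bool _)%:R).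
by apply/idP/idP; rewrite inE.
Qed.

(** A Doob decomposition: the reward plus the current value is telescoped over the steps taken, and
    the one-step identity replaces each increment by its conditional mean. *)
Lemma dv_drift :
  Ex x (fun w => I_ (rho w + (kappa w)%:R * h) w + dv h (N - kappa w) (X (rho w + (kappa w)%:R * h) w)
    - (I_ (rho w) w + dv h N (X (rho w) w))) =
  \sum_(0 <= j < N) Ex x (fun w => \1_[set w | (j < kappa w)%N] w *
    (Q h (dv h (N - j.+1)) (X (rho w + j%:R * h) w) - dv h (N - j) (X (rho w + j%:R * h) w))).
Proof.
pose a w j := I_ (rho w + j%:R * h) w + dv h (N - j) (X (rho w + j%:R * h) w).
have b1 j := (drift_step_bmeas j).1; have b2 j := (drift_step_bmeas j).2.
have bi j : bmeas setT (\1_[set w | (j < kappa w)%N] : Omega -> R).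
  by apply: bmeas_indic; exact: (Fk j).1.
have ba j : bmeas setT (fun w => a w j) by apply: bmeasD => //; exact/b2/dv_cb.
rewrite (@expect_eq _ _ _ _ P x _ (fun w => \sum_(0 <= j < N)
    \1_[set w | (j < kappa w)%N] w * (a w j.+1 - a w j))); last first.
  move=> w; have := @telescope_upto R (a w) _ _ (kN w).
  rewrite /a mul0r addr0 subn0 => <-; apply: eq_bigr => j _; congr (_ * _).
  by rewrite indicE; congr ((nat_of_bool _)%:R); apply/idP/idP; rewrite inE.
rewrite expect_sum => [|j]; last by apply: bmeasM => //; exact: bmeasB.
apply: eq_big_nat => j /andP[_ jN].
have hj : rst F (fun w => rho w + j%:R * h) by apply: rst_addc => //; rewrite mulr_ge0// ltW.
have bjT w : rho w + j%:R * h <= T + j%:R * h by rewrite lerD2r.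
have Es w : rho w + j%:R * h + h = rho w + j.+1%:R * h by rewrite -natr1 mulrDl mul1r addrA.
have bdv := dv_cb (N - j.+1) h0.
have os := onestep nice mk fel cf x hj bjT (Fk j) h0 bdv.
rewrite (@expect_eq _ _ _ _ P x _ (fun w =>
  \1_[set w | (j < kappa w)%N] w * (I_ (rho w + j%:R * h + h) w - I_ (rho w + j%:R * h) w +
     dv h (N - j.+1) (X (rho w + j%:R * h + h) w)) -
  \1_[set w | (j < kappa w)%N] w * dv h (N - j) (X (rho w + j%:R * h) w))); last first.
  by move=> w; rewrite Es -mulrBr; congr (_ * _); rewrite /a; ring.
rewrite expectB; last by apply: bmeasM => //; exact/b2/dv_cb.
  rewrite os -expectB; first by apply: expect_eq => w; rewrite mulrBr.
    by apply: bmeasM => //; apply: b2; exact: (Qop_cb nice mk fel cf (ltW h0) bdv).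
  by apply: bmeasM => //; exact/b2/dv_cb.
rewrite (_ : (fun w => _) = (fun w => \1_[set w | (j < kappa w)%N] w *
  (I_ (rho w + j.+1%:R * h) w - I_ (rho w + j%:R * h) w +
     dv h (N - j.+1) (X (rho w + j.+1%:R * h) w)))); last by apply/funext => w; rewrite Es.
by apply: bmeasM => //; apply: bmeasD; [exact: bmeasB|exact: b2].
Qed.

Lemma drift_final_bmeas :
  bmeas setT (fun w => I_ (rho w + (kappa w)%:R * h) w) /\ bmeas setT (fun w => I_ (rho w) w) /\
  bmeas setT (fun w => dv h N (X (rho w) w)).
Proof.
split; last split.
- exact: (Ipath_bmeas mk cf kappa_time_meas kappa_time_ge0 kappa_time_le).
- exact: (Ipath_bmeas mk cf (rst_meas mk hrho) hrho.1 rhoT).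
- exact: (sample_bmeas mk (dv_cb N h0) (rst_meas mk hrho) hrho.1).
Qed.

(** Since [dv h (N - j)] is a maximum that includes [Q h (dv h (N - j.+1))], no drift term is
    positive. *)
Lemma dv_supermartingale :
  Ex x (fun w => I_ (rho w + (kappa w)%:R * h) w + dv h (N - kappa w) (X (rho w + (kappa w)%:R * h) w))
  <= Ex x (fun w => I_ (rho w) w + dv h N (X (rho w) w)).
Proof.
have [b1 [b2 b3]] := drift_final_bmeas; have b4 := dv_sample_bmeas.
rewrite -subr_le0 -expectB; [|exact: bmeasD|exact: bmeasD].
rewrite dv_drift -oppr_ge0 -sumrN big_nat; apply: sumr_ge0 => j /andP[_ jN].
rewrite oppr_ge0 -[X in _ <= X](expect_cst P x); have bdv := dv_cb (N - j.+1) h0.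
apply: expect_le; last 2 first.
- exact: bmeas_cst.
- move=> w; rewrite -(mulr0 (\1_[set w | (j < kappa w)%N] w)) ler_wpM2l ?indicE// subr_le0.
  by rewrite -[(N - j)%N](subnSK jN) /= le_max lexx orbT.
apply: bmeasM; first by apply: bmeas_indic; exact: (Fk j).1.
apply: bmeasB; last by apply: (drift_step_bmeas j).2; exact: dv_cb.
by apply: (drift_step_bmeas j).2; exact: (Qop_cb nice mk fel cf (ltW h0) bdv).
Qed.

(** Where the rule continues, [g] lies strictly below the maximum, so the maximum is the [Q] term
    and the drift vanishes. *)
Lemma dv_martingale :
  (forall w (j : nat), (j < kappa w)%N -> g (X (rho w + j%:R * h) w) < dv h (N - j) (X (rho w + j%:R * h) w)) ->
  Ex x (fun w => I_ (rho w + (kappa w)%:R * h) w + dv h (N - kappa w) (X (rho w + (kappa w)%:R * h) w))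
  = Ex x (fun w => I_ (rho w) w + dv h N (X (rho w) w)).
Proof.
move=> hk; have [b1 [b2 b3]] := drift_final_bmeas; have b4 := dv_sample_bmeas.
apply/eqP; rewrite -subr_eq0 -expectB; [|exact: bmeasD|exact: bmeasD].
rewrite dv_drift big_nat big1// => j /andP[_ jN].
rewrite -[RHS](expect_cst P x); apply: expect_eq => w; rewrite indicE.
case: (boolP (w \in _)); last by rewrite mul0r.
rewrite inE /= => /hk; rewrite -[(N - j)%N](subnSK jN) /= lt_max ltxx/= mul1r => /ltW gQ.
by rewrite (max_idPr gQ) subrr.
Qed.

End Drift.

(** The rule stops at the first step [j] with [dv h (N - j) <= g]; it exists because [dv h 0] is
    [g]. Continuing only above [g], it has zero drift. The second clause records where it stops, for
    use in [late_optimal]. *)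
Lemma grid_optimal (h : R) (N : nat) : 0 < h -> exists sigma : Omega -> R,
  rst F sigma /\
  (forall w, exists2 j, (j <= N)%N &
     sigma w = j%:R * h /\ dv h (N - j) (X (sigma w) w) <= g (X (sigma w) w)) /\
  (forall x, Ex x (fun w => I_ (sigma w) w + g (X (sigma w) w)) = dv h N x).
Proof.
move=> h0; have ih0 (j : nat) : 0 <= j%:R * h by rewrite mulr_ge0// ltW.
(* The summand 0 is the starting time [rho] of the drift lemmas. *)
pose stop w j := dv h (N - j) (X (0 + j%:R * h) w) <= g (X (0 + j%:R * h) w).
pose kappa w := find (stop w) (iota 0 N.+1).
have hstop w : has (stop w) (iota 0 N.+1).
  by apply/hasP; exists N; [rewrite mem_iota ltnSn|rewrite /stop subnn].
have kN w : (kappa w <= N)%N.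
  by rewrite -ltnS; have := hstop w; rewrite has_find size_iota.
have stopk w : stop w (kappa w).
  by have := nth_find 0%N (hstop w); rewrite -/(kappa w) nth_iota ?ltnS ?kN// add0n.
have kle w j : (j <= N)%N -> stop w j -> (kappa w <= j)%N.
  move=> jN sj; rewrite leqNgt; apply/negP => jk.
  by have := before_find 0%N jk; rewrite nth_iota ?ltnS// add0n sj.
have Fle (j : nat) : F (j%:R * h) [set w | (kappa w <= j)%N].
  have sG := filt_salg mk (ih0 j).
  rewrite (_ : [set w | _] = \bigcup_i [set w | (i <= j)%N /\ (i <= N)%N /\ stop w i]).
    apply: (salg_bigcup sG) => i; case: (pselect ((i <= j)%N)) => ij; last first.
      rewrite (_ : [set w | _] = set0); first exact: (salg0 sG).
      by apply/seteqP; split => // w [].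
    rewrite (_ : [set w | _] = [set w | (i <= N)%N] `\`
        (X (i%:R * h) @^-1` [set y | g y < dv h (N - i) y])).
      apply: (salgD sG); first exact: (salg_const sG).
      apply: (filt_mono mk (ih0 i)); first by rewrite ler_pM2r// ler_nat.
      apply: (adapted mk (ih0 i)); apply: borel_lt; first by case: cg.
      by case: (dv_cb (N - i) h0).
    apply/seteqP; split => w; rewrite /stop add0r /=.
      by move=> [_ [iN hs]]; split => //; rewrite ltNge hs.
    by move=> [iN /negP]; rewrite -leNgt.
  apply/seteqP; split => w /=; first by move=> kj; exists (kappa w) => //=; split.
  by move=> [i _ /= [ij [iN si]]]; exact: leq_trans (kle _ _ iN si) ij.
have Fk (j : nat) : F_at F (fun w => (0 + j%:R * h)%:E) [set w | (j < kappa w)%N].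
  rewrite add0r; apply: F_at_cst => //.
  rewrite (_ : [set w | _] = ~` [set w | (kappa w <= j)%N]).
    exact: (salgC (filt_salg mk (ih0 j))).
  by apply/seteqP; split => w /=; [rewrite ltnNge => /negP|move/negP; rewrite -ltnNge].
pose rho : Omega -> R := fun=> 0.
have hrho : rst F rho by exact: rst_cst.
exists (fun w => 0 + (kappa w)%:R * h); split; last split.
- split; first by move=> w; rewrite add0r.
  move=> t t0; have tm : 0 <= t / h by rewrite divr_ge0// ltW.
  rewrite (_ : [set w | _] = [set w | (kappa w <= Num.truncn (t / h))%N]).
    by apply: (filt_mono mk (ih0 _)) (Fle _); rewrite -ler_pdivlMr// truncn_le.
  by apply/seteqP; split => w /=; rewrite add0r truncn_ge_nat// ler_pdivlMr.
- move=> w; exists (kappa w) => //; rewrite add0r; split => //.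
  by have := stopk w; rewrite /stop add0r.
- move=> x.
  have := @dv_martingale x rho 0 h kappa N hrho (fun=> lexx 0) h0 kN Fk.
  move=> H; rewrite (@expect_eq _ _ _ _ P x _ (fun w => I_ (rho w + (kappa w)%:R * h) w +
      dv h (N - kappa w) (X (rho w + (kappa w)%:R * h) w))); last first.
    move=> w; rewrite /rho; congr (_ + _); apply/eqP; rewrite eq_le dv_ge_g/=.
    exact: stopk.
  rewrite H; last first.
    move=> w j jk; rewrite ltNge; apply/negP => sj.
    have jN : (j <= N)%N by exact: leq_trans (ltnW jk) (kN w).
    by have := kle w j jN sj; rewrite leqNgt jk.
  rewrite -(expect_start x (dv_cb N h0)); apply: expect_eq => w.
  by rewrite /rho /Ipath timeint0 add0r.
Qed.

(** * Dyadic meshes and comparison with arbitrary stopping times *)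

Definition mesh (n : nat) : R := 2^-1 ^+ n.

Lemma mesh_gt0 n : 0 < mesh n.
Proof. by rewrite exprn_gt0// invr_gt0. Qed.

Lemma mesh_cvg : mesh @ \oo --> (0 : R).
Proof. by apply: cvg_expr; rewrite ger0_norm ?invr_ge0// invf_lt1// ltr1n. Qed.

Lemma mulVmesh n : (2 ^ n)%N%:R * mesh n = 1.
Proof. by rewrite /mesh exprVn natrX mulfV// expf_neq0. Qed.

Definition vgrid (n k : nat) : E -> R := dv (mesh n) k.

Definition ugrid (n : nat) : E -> R := vgrid n (n * 2 ^ n).

Lemma vgrid_cb n k : cb (vgrid n k).
Proof. exact/dv_cb/mesh_gt0. Qed.

Lemma vgrid_refine n i k y : vgrid n k y <= vgrid (n + i) (k * 2 ^ i) y.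
Proof.
elim: i => [|i IH]; first by rewrite addn0 expn0 muln1.
apply: le_trans IH _; rewrite /vgrid addnS expnS mulnCA.
have -> : mesh (n + i).+1 = mesh (n + i) / 2 by rewrite /mesh exprSr.
exact/dv_half/mesh_gt0.
Qed.

Lemma vgrid_le n k m l y : (n <= m)%N -> (k * 2 ^ (m - n) <= l)%N -> vgrid n k y <= vgrid m l y.
Proof.
move=> nm kl; apply: le_trans (vgrid_refine n (m - n) k y) _.
by rewrite subnKC//; apply: dv_le => //; exact: mesh_gt0.
Qed.

Lemma ugrid_le n m y : (n <= m)%N -> ugrid n y <= ugrid m y.
Proof.
move=> nm; apply: vgrid_le => //.
by rewrite -mulnA -expnD subnKC// leq_mul2r nm orbT.
Qed.

(** The mesh is at most 1, so [k] steps last at most time [k] and fit into the horizon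
    [maxn n k]. *)
Lemma vgrid_le_ugrid n k y : vgrid n k y <= ugrid (maxn n k) y.
Proof.
apply: vgrid_le; first exact: leq_maxl.
apply: leq_mul; first exact: leq_maxr.
by rewrite leq_exp2l// leq_subr.
Qed.

(* sigma is replaced by the next time of the form rho + k h; the grid values then
   form a supermartingale along these times, and h is sent to 0. *)
Lemma stop_comparison x rho sigma (T : R) (Y : Omega -> R) (N0 : set Omega) :
  rst F rho -> rst F sigma -> (forall w, rho w <= sigma w) -> (forall w, sigma w <= T) ->
  bmeas setT Y -> measurable N0 -> P x N0 = 0%E ->
  (forall w, ~ N0 w -> rho w = sigma w -> g (X (rho w) w) <= Y w) ->
  (forall w, ~ N0 w -> rho w < sigma w -> forall n k, vgrid n k (X (rho w) w) <= Y w) ->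
  Ex x (fun w => I_ (sigma w) w + g (X (sigma w) w)) <= Ex x (fun w => I_ (rho w) w + Y w).
Proof.
move=> hr hs rs sT bY mN0 PN0 Yeq Ylt.
have [cf' [C hC]] := cf; have [cg' [D hD]] := cg.
have rT w : rho w <= T by exact: le_trans (rs w) (sT w).
have T0 : 0 <= T by exact: le_trans (hr.1 point) (rT point).
pose kappa n w := ceiln ((sigma w - rho w) / mesh n).
have q0 n w : 0 <= (sigma w - rho w) / mesh n.
  by rewrite divr_ge0 ?subr_ge0// ltW// mesh_gt0.
pose sig n w := rho w + (kappa n w)%:R * mesh n.
have sigb n w : sigma w <= sig n w <= sigma w + mesh n.
  have /andP[h1 h2] := ceiln_bounds (q0 n w); have m0 := mesh_gt0 n.
  have e : (sigma w - rho w) / mesh n * mesh n = sigma w - rho w by rewrite divfK// gt_eqF.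
  have h1' := ler_wpM2r (ltW m0) h1; have h2' := ler_wpM2r (ltW m0) h2.
  rewrite (mulrDl ((sigma w - rho w) / mesh n)) e mul1r in h2'; rewrite e in h1'.
  by apply/andP; rewrite /sig /kappa; split; lra.
have klt n w (j : nat) : (j < kappa n w)%N = (rho w + j%:R * mesh n < sigma w).
  by rewrite ceiln_gt// ltr_pdivlMr ?mesh_gt0// ltrBrDl.
have Fk n (j : nat) : F_at F (fun w => (rho w + j%:R * mesh n)%:E) [set w | (j < kappa n w)%N].
  rewrite (_ : [set w | _] = [set w | rho w + j%:R * mesh n < sigma w]).
    by apply: F_at_lt => //; apply: rst_addc => //; rewrite mulr_ge0// ltW// mesh_gt0.
  by apply/seteqP; split => w /=; rewrite klt.
pose N n := ceiln (T / mesh n).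
have kN n w : (kappa n w <= N n)%N.
  rewrite leqNgt klt -leNgt; have := hr.1 w.
  have /andP[h1 _] := @ceiln_bounds _ (T / mesh n) (divr_ge0 T0 (ltW (mesh_gt0 n))).
  by move: h1; rewrite ler_pdivrMr ?mesh_gt0// -/(N n); have := sT w; lra.
have main n : Ex x (fun w => I_ (sig n w) w + g (X (sig n w) w)) <= Ex x (fun w => I_ (rho w) w + Y w).
  have h0 := mesh_gt0 n.
  have := dv_supermartingale x hr rT h0 (kN n) (Fk n).
  have b0 := dv_sample_bmeas hr rT h0 (kN n) (Fk n).
  have [b1 [b2 b3]] := drift_final_bmeas hr rT h0 (kN n) (Fk n).
  have b4 := sample_bmeas mk cg (kappa_time_meas hr (kN n) (Fk n)) (kappa_time_ge0 (kappa n) hr h0).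
  pose A w := dv (mesh n) (N n - kappa n w) (X (sig n w) w).
  pose B w := dv (mesh n) (N n) (X (rho w) w).
  rewrite -/A -/B in b0 b3 *.
  rewrite (expectD P x b1 b0) (expectD P x b2 b3) => le1.
  rewrite (expectD P x b1 b4) (expectD P x b2 bY).
  (* Where rho = sigma, [Y] need only dominate [g] and may lie below [B], but then no step is taken
     and [A = B] cancels. Where rho < sigma, [B <= Y] and [g <= A] suffice. *)
  have : Ex x (fun w => g (X (sig n w) w)) <= Ex x (fun w => A w - B w + Y w).
    apply: (bmeasR_le_ae _ (Plty P x) mN0 PN0) => //.
      by apply: bmeasD => //; exact: bmeasB.
    move=> w _ nN; have gA : g (X (sig n w) w) <= A w by exact: dv_ge_g.
    have := rs w; rewrite le_eqVlt => /predU1P[e|l].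
      have k0 : kappa n w = 0%N by apply/eqP; rewrite -leqn0 leqNgt klt mul0r addr0 e ltxx.
      have -> : A w = B w by rewrite /A /B /sig k0 subn0 mul0r addr0.
      by rewrite subrr add0r /sig k0 mul0r addr0; exact: Yeq.
    have BY : B w <= Y w by exact: Ylt.
    by apply: le_trans gA _; rewrite -addrA lerDl addrC subr_ge0.
  rewrite (expectD P x (bmeasB b0 b3) bY) (expectB P x b0 b3); exact: lerD_exchange le1.
have mesh1 n : mesh n <= 1 by rewrite exprn_ile1// ?invr_ge0// invf_le1// ler1n.
have sig0 n w : 0 <= sig n w by exact: kappa_time_ge0 (mesh_gt0 n) w.
have sigcv w : (fun n => sig n w) @ \oo --> sigma w.
  apply: (@squeeze_cvgr _ _ _ _ (fun=> sigma w) (fun n => sigma w + mesh n)).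
  - by apply: nearW => n; exact: sigb.
  - exact: cvg_cst.
  - by rewrite -[X in _ --> X]addr0; apply: cvgD; [exact: cvg_cst|exact: mesh_cvg].
have msig n := kappa_time_meas hr (kN n) (Fk n).
have Cp : 0 <= C by exact: le_trans (normr_ge0 _) (hC point).
(* The times [sig n] tend to sigma from the right, so right-continuity of the path is enough. *)
have cv : (fun n => Ex x (fun w => I_ (sig n w) w + g (X (sig n w) w))) @ \oo -->
    Ex x (fun w => I_ (sigma w) w + g (X (sigma w) w)).
  apply: (@expect_dct _ _ _ _ P x (fun n w => I_ (sig n w) w + g (X (sig n w) w)) _ (C * (T + 1) + D)).
  - move=> n; apply: measurable_funD; first exact: (Ipath_meas mk cf (msig n) (sig0 n)).
    exact: (sample_meas mk cg' (msig n) (sig0 n)).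
  - move=> n w; apply: le_trans (ler_normD _ _) _; apply: lerD => //.
    apply: le_trans (Ipath_bound mk cf w hC (sig0 n w)) _; rewrite ler_wpM2l//.
    have /andP[_ h] := sigb n w; apply: le_trans h _; exact: lerD.
  - move=> w; apply: cvgD.
      apply: (@at_right_seq _ _ (I_ ^~ w) (sigma w) (fun n => sig n w)) => //.
        by apply: (Ipath_rc mk cf); exact: hs.1.
      by move=> n; have /andP[] := sigb n w.
    apply: (@at_right_seq _ _ (fun s => g (X s w)) (sigma w) (fun n => sig n w)) => //.
      by apply: (fpath_rc mk) => //; exact: hs.1.
    by move=> n; have /andP[] := sigb n w.
by apply: (cvgr_to_le cv); exact: nearW.
Qed.

End DynamicProgramming.

(** * Entrance times and the limiting stopping time *)

(** The sequence may reach [t] only if the path takes its left limit there, which the third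
    hypothesis demands. *)
Lemma at_left_seq {R : realType} {U : topologicalType} (phi : R -> U) (t : R) (l : U) (u : nat -> R) :
  phi @ at_left t --> l -> (forall n, u n <= t) -> (forall n, u n = t -> phi t = l) ->
  u @ \oo --> t -> (fun n => phi (u n)) @ \oo --> l.
Proof.
move=> lc ut el cu A nA.
have /= := lc A nA; rewrite /at_left /nbhs/= => /nbhs_ballP[e e0 he].
have /cvgr_dist_lt/(_ e e0)[N _ hN] := cu.
exists N => // n /= Nn.
have := ut n; rewrite le_eqVlt => /predU1P[nt|tn].
  by rewrite nt (el n nt); exact: nbhs_singleton.
by apply: he => //; exact: hN.
Qed.

Lemma limf_esup_ge {R : realType} (phi : R -> \bar R) (c : \bar R) :
  (forall M : R, exists2 T, M <= T & (c <= phi T)%E) -> (c <= limf_esup phi (pinfty_nbhs R))%E.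
Proof.
move=> h; apply: le_ereal_inf_tmp => _ [A [M [_ hM]] <-].
have [T MT cT] := h (M + 1); apply: le_trans cT _; apply: ereal_sup_ubound.
by exists T => //; apply: hM; apply: lt_le_trans MT; rewrite ltrDl.
Qed.

Lemma limf_esup_le {R : realType} (phi : R -> \bar R) (c : \bar R) (M : R) :
  (forall T, M < T -> (phi T <= c)%E) -> (limf_esup phi (pinfty_nbhs R) <= c)%E.
Proof.
move=> h; apply: (@le_trans _ _ (ereal_sup (phi @` [set T | M < T]))).
  by apply: ereal_inf_lbound; exists [set T | M < T] => //; exists M; split; rewrite ?num_real.
by apply: ge_ereal_sup => _ [T /h ? <-].
Qed.

Section Hitting.
Context {R : realType} {E : pmetricType R} {dO : measure_display}
  {Omega : measurableType dO}.
Variables (P : E -> probability Omega R) (X : R -> Omega -> E)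
  (F : R -> set (set Omega)).
Hypothesis mk : standard_markov P X F.

Definition hit (U : set E) (w : Omega) : \bar R :=
  ereal_inf [set t%:E | t in [set t : R | 0 <= t /\ U (X t w)]].

Lemma hit_ge0 U w : (0 <= hit U w)%E.
Proof. by apply: le_ereal_inf_tmp => _ [t [t0 _] <-]; rewrite lee_fin. Qed.

Lemma hit_le U w t : 0 <= t -> U (X t w) -> (hit U w <= t%:E)%E.
Proof. by move=> t0 Ut; apply: ereal_inf_lbound; exists t. Qed.

Lemma hit_sub U V w : U `<=` V -> (hit V w <= hit U w)%E.
Proof.
by move=> UV; apply: le_ereal_inf => _ [t [t0 Ut] <-]; exists t => //; split => //; exact: UV.
Qed.

(** A right-continuous path in the open set [U] at time [r] is in [U] at rational times just after
    [r]. Hence {hit <= t} is decided by rational times up to any [s > t], and right-continuity of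
    the filtration brings it into [F t]. *)
Lemma hit_stopping (U : set E) : open U -> stopping_time F (hit U).
Proof.
move=> oU; split=> [w|t t0]; first exact: hit_ge0.
apply: (filt_rc mk t0) => s ts; have s0 : 0 <= s by exact: le_trans t0 (ltW ts).
have sG := filt_salg mk s0.
rewrite (_ : [set w | _] = \bigcap_(k in [set: nat])
  \bigcup_(q in [set q : rat | [/\ 0 <= ratr q :> R, (ratr q : R) < t + k.+1%:R^-1 & (ratr q : R) <= s]])
    [set w | U (X (ratr q) w)]).
  apply: (salg_bigcap sG) => k; apply: (salg_bigcup_rat sG) => q [q0 _ qs].
  apply: (filt_mono mk q0 qs); apply: (adapted mk q0).
  by apply: sub_sigma_algebra.
apply/seteqP; split => w /=.
  move=> ht k _; pose b := Num.min (t + k.+1%:R^-1) s.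
  have tb : t < b by rewrite lt_min ts andbT ltrDl invr_gt0.
  have /ereal_inf_lt[_ [r [r0 Ur] <-] rb] : (hit U w < b%:E)%E.
    by apply: le_lt_trans ht _; rewrite lte_fin.
  have nU : nbhs (X r w) U by exact: open_nbhs_nbhs.
  have /= := @path_rc _ _ _ _ P X F mk w r r0 _ nU; rewrite /at_right /nbhs/= => /nbhs_ballP[e /= e0 he].
  have [q] : exists q, ratr q \in `]r, Num.min (r + e) b[.
    by apply: rat_in_itvoo; rewrite lt_min ltrDl e0 -lte_fin.
  rewrite in_itv/= lt_min => /andP[rq /andP[qe]]; rewrite lt_min => /andP[q1 q2].
  exists q; first by split => //; [exact: le_trans r0 (ltW rq)|exact: ltW].
  by apply: he => //; rewrite /ball/= ltr_norml; apply/andP; split; lra.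
move=> h; apply/lee_addgt0Pr => e e0.
have [k _ hk] := near_infty_natSinv_lt (PosNum e0).
have [q [q0 qt _] Uq] := h k I.
apply: le_trans (hit_le q0 Uq) _; rewrite -EFinD lee_fin; apply: ltW.
by apply: lt_trans qt _; rewrite ltrD2l; exact: (hk k (leqnn k)).
Qed.

(** The infimum need not be attained. If [phi] were positive at time [t], it would stay so on some
    [t, t + e), the path would avoid [U] there, and the infimum would be at least [t + e]. *)
Lemma hit_boundary (U : set E) (phi : E -> R) w t : continuous phi -> 0 <= t ->
  (forall y, U y -> phi y <= 0) -> hit U w = t%:E -> phi (X t w) <= 0.
Proof.
move=> cphi t0 hU ht; rewrite leNgt; apply/negP => pos.
have := @fpath_rc _ _ _ _ P X F mk phi w t cphi t0 => /cvgr_gt/(_ 0 pos).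
rewrite /at_right /= => /nbhs_ballP[e /= e0 he].
suff : (t%:E + e%:E <= t%:E)%E by rewrite -EFinD lee_fin gerDl leNgt e0.
rewrite -[leRHS]ht; apply: le_ereal_inf_tmp => _ [r [r0 Ur] <-].
rewrite -EFinD lee_fin leNgt; apply/negP => re.
have tr : t <= r by rewrite -lee_fin -ht; exact: hit_le.
have := hU _ Ur; rewrite leNgt => /negP; apply.
move: tr; rewrite le_eqVlt => /predU1P[<-//|tr].
by apply: he => //; rewrite /ball/= ltr_norml; apply/andP; split; lra.
Qed.

(** For constant [s] this is [stop_min] by conversion; the random cap is needed for the minimum of
    two stopping times. *)
Definition smin (tau : Omega -> \bar R) (s : Omega -> R) (w : Omega) : R :=
  fine (Order.min (tau w) (s w)%:E).

Lemma sminE tau s w : (0 <= tau w)%E -> (smin tau s w)%:E = Order.min (tau w) (s w)%:E.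
Proof.
rewrite /smin => tau0; rewrite fineK//; case: (tau w) tau0 => [r _||] //=.
by case: (leP r%:E (s w)%:E).
Qed.

Lemma smin_le tau s w : (0 <= tau w)%E -> smin tau s w <= s w.
Proof. by move=> t0; rewrite -lee_fin sminE// ge_min lexx orbT. Qed.

Lemma smin_rst tau s : stopping_time F tau -> rst F s -> rst F (smin tau s).
Proof.
move=> [tau0 ht] [s0 hs]; split.
  by move=> w; rewrite -lee_fin sminE// le_min tau0 lee_fin s0.
move=> t t0; have sG := filt_salg mk t0.
rewrite (_ : [set w | _] = [set w | (tau w <= t%:E)%E] `|` [set w | s w <= t]).
  by apply: (salgU sG); [exact: ht|exact: hs].
have e w : smin tau s w <= t = (tau w <= t%:E)%E || (s w <= t).
  by rewrite -[LHS]lee_fin sminE// ge_min lee_fin.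
by apply/seteqP; split => w /=; rewrite e => /orP.
Qed.

End Hitting.

(** * The value as a limit of grid values; identification of tau* up to a null set *)

Section LimitingStoppingTime.
Context {R : realType} {E : pmetricType R} {dO : measure_display}
  {Omega : measurableType dO}.
Variables (P : E -> probability Omega R) (X : R -> Omega -> E)
  (F : R -> set (set Omega)) (f g d : E -> R).
Notation borelE := (g_sigma_algebraType (@open E)).
Hypothesis nice : nice_space E.
Hypothesis mk : standard_markov P X F.
Hypothesis fel : weak_feller P X.
Hypothesis (cf : cb f) (cg : cb g).
Notation Ex := (expect P).
Notation I_ := (Ipath X f).
Notation ug := (ugrid P X f g).
Notation vg := (vgrid P X f g).
Notation val := (value P X F f g).

Lemma payoffE x tau T : stopping_time F tau -> 0 <= T ->
  payoff P X f g x tau T =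
  (Ex x (fun w => I_ (smin tau (fun=> T) w) w + g (X (smin tau (fun=> T) w) w)))%:E.
Proof.
move=> ht T0; have rT := smin_rst mk ht (rst_cst mk T0).
have [cf' [C hC]] := cf.
have b : bmeas setT (fun w => I_ (smin tau (fun=> T) w) w + g (X (smin tau (fun=> T) w) w)).
  apply: bmeasD; last exact: (sample_bmeas mk cg (rst_meas mk rT) rT.1).
  apply: (Ipath_bmeas mk cf (rst_meas mk rT) rT.1) => w.
  by apply: smin_le; exact: ht.1.
rewrite /payoff -(Rintegral_EFin measurableT (Plty P x) b); apply: eq_integral => w _.
rewrite EFinD; congr (_ + _)%E; rewrite /Ipath /timeint.
rewrite Rintegral_EFin//; first exact: leb_itv_lty.
apply: (@bmeas_path _ _ C) => // s s0; exact: (fpath_rc mk).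
Qed.

Lemma gamma_integrand x tau T w : stopping_time F tau -> 0 <= T ->
  (\int[@lebesgue_measure R]_(s in `[0%R, stop_min tau T w]) (f (X s w) - d x)%:E =
   (I_ (smin tau (fun=> T) w) w - d x * smin tau (fun=> T) w)%:E)%E.
Proof.
move=> ht T0; have rT := smin_rst mk ht (rst_cst mk T0).
have [cf' [C hC]] := cf.
have bp : bmeas `[0, smin tau (fun=> T) w] (fun s => f (X s w)).
  by apply: (@bmeas_path _ _ C) => // s s0; exact: (fpath_rc mk).
have b : bmeas `[0, smin tau (fun=> T) w] (fun s => f (X s w) - d x).
  by apply: bmeasB => //; exact: bmeas_cst.
rewrite /stop_min -/(smin tau (fun=> T) w) Rintegral_EFin//; last exact: leb_itv_lty.
congr (_%:E); rewrite bmeasRB//; [|exact: leb_itv_lty|exact: bmeas_cst].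
by congr (_ - _); rewrite Rintegral_cst_itv ?subr0//; exact: rT.1.
Qed.

Lemma smin_const (s : Omega -> R) (T : R) : (forall w, s w <= T) ->
  smin (fun w => (s w)%:E) (fun=> T) = s.
Proof.
move=> sT; apply/funext => w; rewrite /smin (min_idPl _)//.
by rewrite lee_fin.
Qed.

(** The optimal grid rule is bounded by [n], so its payoff no longer changes once [T] exceeds
    [n]. *)
Lemma ugrid_le_value n x : ((ug n x)%:E <= val x)%E.
Proof.
have [s [rs [hs es]]] := grid_optimal nice mk fel cf cg (n * 2 ^ n) (mesh_gt0 n).
have sn w : s w <= n%:R.
  have [j jN [-> _]] := hs w.
  have -> : n%:R = (n * 2 ^ n)%N%:R * mesh n :> R by rewrite natrM -mulrA mulVmesh mulr1.
  by rewrite ler_pM2r ?mesh_gt0// ler_nat.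
have st : stopping_time F (fun w => (s w)%:E) by apply/rst_stopping.
apply: (@le_trans _ _ (lim_payoff P X f g x (fun w => (s w)%:E))); last first.
  by apply: ereal_sup_ubound; exists (fun w => (s w)%:E).
apply: limf_esup_ge => M; exists (Num.max M n%:R); first by rewrite le_max lexx.
rewrite payoffE//; last by rewrite le_max ler0n orbT.
rewrite smin_const ?es// => w; apply: le_trans (sn w) _.
by rewrite le_max lexx orbT.
Qed.

(** Any rule cut at [T] is compared with stopping at time 0 for the constant reward [c]. Together
    with [ugrid_le_value] this makes the value the supremum of the [ug n]. *)
Lemma value_le x (c : R) : (forall n, ug n x <= c) -> (val x <= c%:E)%E.
Proof.
move=> hc; apply: ge_ereal_sup => _ [tau ht <-].
apply: (@limf_esup_le _ _ _ 0) => T /ltW T0.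
rewrite payoffE// lee_fin; have rT := smin_rst mk ht (rst_cst mk T0).
have r0 := rst_cst mk (lexx 0).
have [mN PN] := start_null mk x.
have := @stop_comparison _ _ _ _ P X F f g nice mk fel cf cg x (fun=> 0) _ T (fun=> c) _
  r0 rT rT.1 (fun w => smin_le _ (ht.1 w)) (bmeas_cst _ c) mN PN.
rewrite (@expect_eq _ _ _ _ P x (fun w => I_ 0 w + c) (fun=> c)); last first.
  by move=> w; rewrite /Ipath timeint0 add0r.
rewrite expect_cst; apply.
  by move=> w /contrapT -> _; apply: le_trans (hc 0%N); exact: (dv_ge_g _ _ _ _ _ 0).
move=> w /contrapT -> _ n k.
exact: le_trans (vgrid_le_ugrid nice mk fel cf cg n k x) (hc _).
Qed.

Definition region (n : nat) : set E := [set y | ug n y < g y + n.+1%:R^-1].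

Lemma region_open n : open (region n).
Proof.
have [cu _] := vgrid_cb nice mk fel cf cg n (n * 2 ^ n); have [cg' _] := cg.
have cphi : continuous (fun y => g y + n.+1%:R^-1 - ug n y).
  by move=> y; apply: cvgB; [apply: cvgD; [exact: cg'|exact: cvg_cst]|exact: cu].
rewrite (_ : region n = (fun y => g y + n.+1%:R^-1 - ug n y) @^-1` [set r | 0 < r]).
  by move/continuousP: cphi; apply; exact: open_gt.
by apply/seteqP; split => y; rewrite /region /= subr_gt0.
Qed.

Definition capped_hit (n : nat) : Omega -> R := smin (hit X (region n)) (fun=> n%:R).

Lemma capped_hit_rst n : rst F (capped_hit n).
Proof.
apply: (smin_rst mk); first exact: (hit_stopping mk (region_open n)).
exact: (rst_cst mk (ler0n _ n)).
Qed.

Lemma capped_hitE n w : (capped_hit n w)%:E = Order.min (hit X (region n) w) n%:R%:E.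
Proof. by rewrite /capped_hit sminE// hit_ge0. Qed.

Lemma capped_hit_leS n w : capped_hit n w <= capped_hit n.+1 w.
Proof.
rewrite -lee_fin !capped_hitE le_min !ge_min; apply/andP; split; apply/orP.
  left; apply: hit_sub => y; rewrite /region /= => h.
  apply: le_lt_trans (ugrid_le nice mk fel cf cg y (leqnSn n)) (lt_le_trans h _).
  by rewrite lerD2l lef_pV2 ?posrE// ler_nat.
by right; rewrite lee_fin ler_nat.
Qed.

Definition tinf (w : Omega) : \bar R := ereal_sup (range (fun n => (capped_hit n w)%:E)).

Lemma capped_hit_le_tinf n w : ((capped_hit n w)%:E <= tinf w)%E.
Proof. by apply: ereal_sup_ubound; exists n. Qed.

Lemma capped_hit_cvg w : (fun n => (capped_hit n w)%:E) @ \oo --> tinf w.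
Proof.
apply: ereal_nondecreasing_cvgn; apply/nondecreasing_seqP => n.
by rewrite lee_fin; exact: capped_hit_leS.
Qed.

Lemma tinf_stopping : stopping_time F tinf.
Proof.
split=> [w|t t0].
  by apply: le_trans (capped_hit_le_tinf 0 w); rewrite lee_fin; exact: (capped_hit_rst 0).1.
rewrite (_ : [set w | _] = \bigcap_n [set w | capped_hit n w <= t]).
  by apply: (salg_bigcap (filt_salg mk t0)) => n; exact: (capped_hit_rst n).2.
apply/seteqP; split => w /=.
  by move=> h n _ /=; rewrite -lee_fin; exact: le_trans (capped_hit_le_tinf n w) h.
by move=> h; apply: ge_ereal_sup => _ [n _ <-]; rewrite lee_fin; exact: h.
Qed.

(** The limit time is finite but the state there is outside {w <= g}. Writing this with the
    continuous [ug j] makes the set measurable. It does not involve the starting point, whereas the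
    null sets supplied by quasi-left-continuity do; the augmentation argument needs one set that is
    null for all of them. *)
Definition exceptional : set Omega :=
  [set w | (tinf w < +oo)%E /\ exists j, g (X (fine (tinf w)) w) < ug j (X (fine (tinf w)) w)].

Lemma tinf_ge0 w : (0 <= tinf w)%E.
Proof. exact: tinf_stopping.1. Qed.

Lemma fine_tinf_meas : measurable_fun setT (fun w => fine (tinf w)).
Proof.
by apply: measurableT_comp; [exact: fine_measurable|exact: (stopping_meas mk tinf_stopping)].
Qed.

Lemma exceptional_meas : measurable exceptional.
Proof.
have [cg' _] := cg.
rewrite (_ : exceptional = [set w | (tinf w < +oo)%E] `&`
    \bigcup_j [set w | g (X (fine (tinf w)) w) < ug j (X (fine (tinf w)) w)]).
  apply: measurableI.
    rewrite -[X in measurable X]setTI.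
    apply: emeasurable_fun_infty_o => //; exact: (stopping_meas mk tinf_stopping).
  have s (phi : E -> R) : continuous phi -> measurable_fun setT (fun w => phi (X (fine (tinf w)) w)).
    move=> cphi; apply: (sample_meas mk cphi fine_tinf_meas) => w.
    by rewrite fine_ge0// tinf_ge0.
  apply: bigcupT_measurable => j; apply: measurable_set_lt; apply: s => //.
  by have [] := vgrid_cb nice mk fel cf cg j (j * 2 ^ j).
by apply/seteqP; split => w [h1 [j]]; [move=> h2; split => //; exists j|move=> _ h2; split => //; exists j].
Qed.

Lemma qlc x : exists N : set Omega, [/\ measurable N, P x N = 0%E &
  forall w, ~ N w -> (tinf w < +oo)%E -> (fun n => X (capped_hit n w) w) @ \oo --> X (fine (tinf w)) w].
Proof.
have := mk; rewrite /standard_markov => -[_ [_ [_ [_ [_ [_ [_ [_ [_ q]]]]]]]]].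
have [|||N [mN [PN hN]]] := q x (fun n w => (capped_hit n w)%:E) tinf _ tinf_stopping.
- by move=> n; apply/rst_stopping; exact: capped_hit_rst.
- by move=> w n; rewrite lee_fin; exact: capped_hit_leS.
- exact: capped_hit_cvg.
by exists N; split.
Qed.

(** For large [n] the cap is inactive, so [hit_boundary] gives [ug n - g <= 1/(n+1)] at the entrance
    state, and [ug j <= ug n] once [n >= j]. Continuity of [ug j] and [g] passes this to the limit
    state. *)
Lemma exceptional_sub w : (tinf w < +oo)%E -> (fun n => X (capped_hit n w) w) @ \oo --> X (fine (tinf w)) w ->
  ~ exceptional w.
Proof.
move=> tfin cv [_ [j]]; apply/negP; rewrite -leNgt.
have [cg' _] := cg; have [cu _] := vgrid_cb nice mk fel cf cg j (j * 2 ^ j).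
have tE : tinf w = (fine (tinf w))%:E by rewrite fineK// ge0_fin_numE// tinf_ge0.
rewrite -subr_le0.
have c : (fun n => ug j (X (capped_hit n w) w) - g (X (capped_hit n w) w) - n.+1%:R^-1) @ \oo -->
    ug j (X (fine (tinf w)) w) - g (X (fine (tinf w)) w).
  rewrite -[X in _ --> X]subr0; apply: cvgB; last exact: cvg_harmonic.
  by apply: cvgB; [exact: continuous_cvg (cu _) cv|exact: continuous_cvg (cg' _) cv].
(* Beyond this index [n] exceeds both [j] and the limit time, so that [capped_hit n] is the true
   entrance time. *)
apply: (cvgr_to_le c); exists (maxn j (Num.truncn (fine (tinf w))).+1) => // n /=.
rewrite geq_max => /andP[jn tn].
have rn : capped_hit n w < n%:R.
  apply: (@le_lt_trans _ _ (fine (tinf w))); first by rewrite -lee_fin -tE capped_hit_le_tinf.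
  by apply: lt_le_trans (truncnS_gt _) _; rewrite ler_nat.
have hE : hit X (region n) w = (capped_hit n w)%:E.
  have := capped_hitE n w; case: (leP (hit X (region n) w) n%:R%:E) => // _ [e].
  by move: rn; rewrite e ltxx.
have [cun _] := vgrid_cb nice mk fel cf cg n (n * 2 ^ n).
have := @hit_boundary _ _ _ _ P X F mk (region n) (fun y => ug n y - g y - n.+1%:R^-1) w _ _
  ((capped_hit_rst n).1 w) _ hE.
move=> h; apply: le_trans (h _ _).
- by rewrite !lerD2r; exact: (ugrid_le nice mk fel cf cg).
- by move=> y; apply: cvgB; [apply: cvgB; [exact: cun|exact: cg']|exact: cvg_cst].
- by move=> y; rewrite /region /= => /ltW; rewrite -addrA -opprD subr_le0.
Qed.

Lemma exceptional_null x : P x exceptional = 0%E.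
Proof.
have [N [mN PN hN]] := qlc x; apply: (subset_measure0 exceptional_meas mN _ PN) => w hb.
apply: contrapT => nN; apply: (exceptional_sub _ _ hb); first by case: hb.
by apply: hN => //; case: hb.
Qed.

(** Holds on every path: {w <= g} lies in each region because [ug n <= w]. *)
Lemma tinf_le_star w : (tinf w <= tau_star X g val w)%E.
Proof.
apply: ge_ereal_sup => _ [n _ <-]; rewrite capped_hitE ge_min; apply/orP; left.
(* [tau_star] is, by conversion, the entrance time of {w <= g}. *)
apply: (@hit_sub _ _ _ _ X [set y | (val y <= (g y)%:E)%E]) => y /= h.
rewrite /region /=; apply: (@le_lt_trans _ _ (g y)); last by rewrite ltrDl invr_gt0.
by rewrite -lee_fin; apply: le_trans h; exact: ugrid_le_value.
Qed.

(** Off the exceptional set all [ug n <= g] at the limit state, hence [w <= g] there by [value_le],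
    and tau* has occurred. *)
Lemma star_eq w : ~ exceptional w -> tau_star X g val w = tinf w.
Proof.
move=> nb; apply/eqP; rewrite eq_le tinf_le_star andbT.
case: (leP +oo%E (tinf w)) => h; first by apply: le_trans h; exact: leey.
have tE : tinf w = (fine (tinf w))%:E by rewrite fineK// ge0_fin_numE// tinf_ge0.
rewrite tE; apply: (@hit_le _ _ _ _ X [set y | (val y <= (g y)%:E)%E]).
  by rewrite fine_ge0// tinf_ge0.
apply: value_le => n; rewrite leNgt; apply/negP => hn.
by apply: nb; split => //; exists n.
Qed.

Lemma star_stopping : stopping_time F (tau_star X g val).
Proof.
split=> [w|t t0]; first exact: le_trans (tinf_ge0 w) (tinf_le_star w).
have := mk; rewrite /standard_markov => -[_ [_ [aug _]]].
apply: (aug t t0) => mu; exists [set w | (tinf w <= t%:E)%E], exceptional.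
have z : (fun y : borelE => P y exceptional) = cst 0%E by apply/funext => y; exact: exceptional_null.
split; first exact: tinf_stopping.2.
split; first exact: exceptional_meas.
split; first by rewrite z; exact: measurable_cst.
split.
  by rewrite /Pmix; under eq_integral do rewrite exceptional_null; rewrite integral0.
by move=> w /= h; apply: contrapT => /star_eq e; case: h => -[]; rewrite /= e.
Qed.

End LimitingStoppingTime.

(** * Optimality and the mean of the limiting stopping time *)

Section Optimality.
Context {R : realType} {E : pmetricType R} {dO : measure_display}
  {Omega : measurableType dO}.
Variables (P : E -> probability Omega R) (X : R -> Omega -> E)
  (F : R -> set (set Omega)) (f g d : E -> R).
Hypothesis nice : nice_space E.
Hypothesis mk : standard_markov P X F.
Hypothesis fel : weak_feller P X.
Hypothesis (cf : cb f) (cg : cb g).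
Notation Ex := (expect P).
Notation I_ := (Ipath X f).
Notation ug := (ugrid P X f g).
Notation vg := (vgrid P X f g).
Notation val := (value P X F f g).
Notation tstar := (tau_star X g val).
Notation rho := (capped_hit P X f g).
Notation tlim := (tinf P X f g).
Notation exc := (exceptional P X f g).

(** The doubled horizon leaves at least [n] units of time whenever the rule stops before time [n].
    The remaining grid value then dominates [ug n], so the stopping state lies in [region n]. *)
Lemma late_optimal : exists s : nat -> Omega -> R, forall n,
  [/\ rst F (s n), (forall w, s n w <= (2 * n)%N%:R), (forall w, rho n w <= s n w) &
      forall x, Ex x (fun w => I_ (s n w) w + g (X (s n w) w)) = ug (2 * n) x].
Proof.
have H n : exists s : Omega -> R,
  [/\ rst F s, (forall w, s w <= (2 * n)%N%:R), (forall w, rho n w <= s w) &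
      forall x, Ex x (fun w => I_ (s w) w + g (X (s w) w)) = ug (2 * n) x]; last first.
  by have [s hs] := choice H; exists s.
pose h : R := mesh (2 * n); pose N := (2 * n * 2 ^ (2 * n))%N.
have [s [rs [hs es]]] := grid_optimal nice mk fel cf cg N (@mesh_gt0 R (2 * n)).
have h0 : 0 < h := mesh_gt0 (2 * n).
have hN (m : nat) : m%:R = (m * 2 ^ (2 * n))%N%:R * h by rewrite natrM -mulrA mulVmesh mulr1.
exists s; split => //.
  by move=> w; have [j jN [-> _]] := hs w; rewrite (hN (2 * n)%N) ler_pM2r// ler_nat.
move=> w; have [j jN [sj le_g]] := hs w; rewrite -lee_fin capped_hitE ge_min.
case: (leP n%:R (s w)) => ns; apply/orP; first by right; rewrite lee_fin.
left; apply: hit_le; first exact: rs.1.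
rewrite /region /=; apply: (@le_lt_trans _ _ (g (X (s w) w))); last by rewrite ltrDl invr_gt0.
apply: le_trans le_g; apply: (vgrid_le nice mk fel cf cg); first by rewrite leq_pmull.
move: ns; rewrite sj (hN n) ltr_pM2r// ltr_nat => jn.
have NE : N = (n * 2 ^ (2 * n) + n * 2 ^ (2 * n))%N by rewrite /N -mulnA mul2n addnn.
rewrite -mulnA -expnD subnKC ?leq_pmull// NE; move: jn.
by move: (n * 2 ^ (2 * n))%N => a; lia.
Qed.

Lemma gamma_lower x sigma T : rst F sigma -> (forall w, sigma w <= T) ->
  ((Ex x (fun w => I_ (sigma w) w - d x * sigma w))%:E <= gamma_fun P X F f d x)%E.
Proof.
move=> rs sT; have st : stopping_time F (fun w => (sigma w)%:E) by apply/rst_stopping.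
have T0 : 0 <= T by exact: le_trans (rs.1 point) (sT point).
have ms := rst_meas mk rs.
apply: le_trans; last by apply: ereal_sup_ubound; exists (fun w => (sigma w)%:E).
apply: limf_esup_ge => M; exists (Num.max M T); first by rewrite le_max lexx.
have T1 : 0 <= Num.max M T by rewrite le_max T0 orbT.
have b : bmeas setT (fun w => I_ (sigma w) w - d x * sigma w).
  apply: bmeasB; first exact: (Ipath_bmeas mk cf ms rs.1 sT).
  by apply: bmeasZ; split => //; exists T => w _; rewrite ger0_norm ?rs.1.
rewrite -(Rintegral_EFin measurableT (Plty P x) b) le_eqVlt; apply/orP; left; apply/eqP.
apply: eq_integral => w _; rewrite (gamma_integrand d mk cf x w st T1) smin_const// => v.
by apply: le_trans (sT v) _; rewrite le_max lexx orbT.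
Qed.

(** Write -d E sigma as E(I - d sigma) - E I. The first term is at most [c]; the last hypothesis,
    that the rule does as well as stopping at once, gives E I >= g(x) - K >= -2K. *)
Lemma mean_bound x sigma T (c K : R) : rst F sigma -> (forall w, sigma w <= T) ->
  gamma_fun P X F f d x = c%:E -> d x < 0 -> (forall y, `|g y| <= K) ->
  g x <= Ex x (fun w => I_ (sigma w) w + g (X (sigma w) w)) ->
  Ex x sigma <= (c + 2 * K) / (- d x).
Proof.
move=> rs sT gc dx hK gx; have ms := rst_meas mk rs.
have bI := Ipath_bmeas mk cf ms rs.1 sT.
have bs : bmeas setT sigma by split => //; exists T => w _; rewrite ger0_norm ?rs.1.
have bg := sample_bmeas mk cg ms rs.1.
have := gamma_lower x rs sT; rewrite gc lee_fin.
rewrite expectB//; last exact: bmeasZ.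
rewrite expectZ//; rewrite expectD// in gx.
have gK : Ex x (fun w => g (X (sigma w) w)) <= K.
  rewrite -[leRHS](expect_cst P x); apply: expect_le => //; first exact: bmeas_cst.
  by move=> w; exact: le_trans (ler_norm _) (hK _).
have gxK : - K <= g x by have := hK x; rewrite ler_norml => /andP[].
rewrite ler_pdivlMr ?oppr_gt0// mulrN [Ex x sigma * _]mulrC => h.
by move: h gx gK gxK; move: (d x * _) (Ex x _) => a b; lra.
Qed.

Lemma mean_tinf x (M : R) : (forall n, Ex x (rho n) <= M) ->
  (\int[P x]_w tlim w <= M%:E)%E.
Proof.
move=> hM.
have rr0 n w : 0 <= rho n w by exact: (capped_hit_rst nice mk fel cf cg n).1.
have mrr n := rst_meas mk (capped_hit_rst nice mk fel cf cg n).
have nd w : {homo (fun n => (rho n w)%:E) : m n / (m <= n)%N >-> (m <= n)%E}.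
  by apply/nondecreasing_seqP => n; rewrite lee_fin; exact: (capped_hit_leS nice mk fel cf cg).
have c := @cvg_monotone_convergence _ _ _ (P x) setT measurableT (fun n w => (rho n w)%:E)
  (fun n => (measurable_EFinP _ _).2 (mrr n)) (fun n w _ => rr0 n w) (fun w _ => nd w).
have -> : (\int[P x]_w tlim w = \int[P x]_w limn (fun n => (rho n w)%:E))%E.
  by apply: eq_integral => w _; apply/esym/cvg_lim => //; exact: (capped_hit_cvg nice mk fel cf cg).
rewrite -(cvg_lim _ c)//; apply: lime_le; first by apply/cvg_ex; eexists; exact: c.
apply: nearW => n; have b : bmeas setT (rho n).
  split; first exact: mrr.
  by exists n%:R => w _; rewrite ger0_norm// /capped_hit; apply: smin_le; exact: hit_ge0.
rewrite (Rintegral_EFin measurableT (Plty P x) b) lee_fin; exact: hM.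
Qed.

(** Quasi-left-continuity speaks only of the times [rho n]; here convergence of the state is
    transferred, path by path, to any times squeezed between [rho n] and the limit. *)
Lemma sample_cvg w (t : R) (u : nat -> R) : tlim w = t%:E ->
  (fun n => X (rho n w) w) @ \oo --> X t w ->
  (forall n, rho n w <= u n) -> (forall n, u n <= t) ->
  u @ \oo --> t /\ (fun n => X (u n) w) @ \oo --> X t w.
Proof.
move=> tE cX ru ut.
have rt n : rho n w <= t by rewrite -lee_fin -tE; exact: capped_hit_le_tinf.
have rc : (fun n => rho n w) @ \oo --> t.
  have := @capped_hit_cvg _ _ _ _ P X F f g nice mk fel cf cg w; rewrite tE => /fine_cvg; apply: cvg_trans.
  by apply: near_eq_cvg; exact: nearW.
have uc : u @ \oo --> t.
  by apply: (squeeze_cvgr _ rc (cvg_cst t)); apply: nearW => n; rewrite ru ut.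
split => //.
have mono m n : (m <= n)%N -> rho m w <= rho n w.
  have /nondecreasing_seqP : forall k, rho k w <= rho k.+1 w by move=> k; exact: (capped_hit_leS nice mk fel cf cg).
  exact.
have [[m rm]|nr] := pselect (exists m, rho m w = t).
  apply: cvg_near_cst; exists m => // n /= mn; congr X.
  by apply/eqP; rewrite eq_le ut/= -rm (le_trans (mono _ _ mn)).
have rlt n : rho n w < t.
  by rewrite lt_neqAle rt andbT; apply/eqP => e; apply: nr; exists n.
have t0 : 0 < t by apply: le_lt_trans (rlt 0%N); exact: (capped_hit_rst nice mk fel cf cg 0).1.
have [l hl] := path_ll mk w t0.
(* The [rho n] approach [t] strictly from the left, so their states tend to the left limit; by [cX]
   they also tend to [X t w]. *)
have lE : X t w = l.
  apply: (cvg_unique (@metric_hausdorff _ E) cX).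
  apply: (@at_left_seq _ _ (fun s => X s w) t l (fun n => rho n w)) => // n e.
  by have := rlt n; rewrite e ltxx.
rewrite lE; apply: (@at_left_seq _ _ (fun s => X s w) t l u) => //.
Qed.

(** [J n] is the payoff of the late optimal rule cut at the limit time, with mean at least
    [ug (2 * n) x]; [J' n] is that of tau* cut at [n], which the limsup sees. Both times are almost
    surely squeezed between [rho n] and the limit time, and the finite mean of the latter dominates
    the difference. *)
Lemma value_le_lim_payoff x (M : R) : (\int[P x]_w tlim w <= M%:E)%E ->
  (val x <= lim_payoff P X f g x tstar)%E.
Proof.
move=> hM.
have st := star_stopping nice mk fel cf cg.
have ti := tinf_stopping nice mk fel cf cg.
have [s hs] := late_optimal.
pose r n := smin tlim (s n).
pose r' n := smin tstar (fun=> n%:R).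
have rs n : rst F (s n) by case: (hs n).
have rst_r n : rst F (r n) by exact: (smin_rst mk).
have rst_r' n : rst F (r' n) by apply: (smin_rst mk) => //; exact: (rst_cst mk).
have r_le n w : r n w <= s n w by apply: smin_le; exact: ti.1.
have sN n w : s n w <= (2 * n)%N%:R by case: (hs n).
pose J n w := I_ (r n w) w + g (X (r n w) w).
pose J' n w := I_ (r' n w) w + g (X (r' n w) w).
have bJ n : bmeas setT (J n).
  apply: bmeasD; last exact: (sample_bmeas mk cg (rst_meas mk (rst_r n)) (rst_r n).1).
  apply: (Ipath_bmeas mk cf (rst_meas mk (rst_r n)) (rst_r n).1 (T := (2 * n)%N%:R)) => w.
  exact: le_trans (r_le n w) (sN n w).
have bJ' n : bmeas setT (J' n).
  apply: bmeasD; last exact: (sample_bmeas mk cg (rst_meas mk (rst_r' n)) (rst_r' n).1).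
  apply: (Ipath_bmeas mk cf (rst_meas mk (rst_r' n)) (rst_r' n).1 (T := n%:R)) => w.
  by apply: smin_le; exact: st.1.
have [cf' [C hC]] := cf; have [cg' [D hD]] := cg.
have C0 : 0 <= C by exact: le_trans (normr_ge0 _) (hC point).
have D0 : 0 <= D by exact: le_trans (normr_ge0 _) (hD point).
have optJ n : ug (2 * n) x <= Ex x (J n).
  have [_ _ _ es] := hs n; rewrite -es.
  rewrite [leRHS](@expect_eq _ _ _ _ P x _ (fun w => I_ (r n w) w + g (X (r n w) w)))//.
  (* The rule [s n] is compared with its cut at the limit time. Where the cut is effective the state
     is at the limit time, and there every grid value is at most [g] off the exceptional set. *)
  apply: (stop_comparison nice mk fel cf cg (rst_r n) (rs n) (r_le n) (sN n)
    (sample_bmeas mk cg (rst_meas mk (rst_r n)) (rst_r n).1)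
    (exceptional_meas nice mk fel cf cg) (exceptional_null nice mk fel cf cg x)) => //.
  move=> w nb lt_rs m k; apply: le_trans (vgrid_le_ugrid nice mk fel cf cg m k _) _.
  have tl : (tlim w < (s n w)%:E)%E.
    rewrite ltNge; apply/negP => h; move: lt_rs; rewrite /r /smin (min_idPr h)/= ltxx.
    by [].
  have -> : r n w = fine (tlim w) by rewrite /r /smin (min_idPl (ltW tl)).
  rewrite leNgt; apply/negP => hb; apply: nb; split; first by rewrite (lt_trans tl)// ltry.
  by exists (maxn m k).
have [N [mN PN hN]] := qlc nice mk fel cf cg x.
have mt := stopping_meas mk ti.
have it : (P x).-integrable setT tlim.
  apply/integrableP; split => //; apply: (@le_lt_trans _ _ M%:E); last exact: ltry.
  apply: le_trans hM; rewrite le_eqVlt; apply/orP; left; apply/eqP.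
  by apply: eq_integral => w _; rewrite gee0_abs//; exact: ti.1.
have dctc : (fun n => Ex x (fun w => J' n w - J n w)) @ \oo --> (0 : R).
  pose h n w := (J' n w - J n w)%:E.
  have mh n : measurable_fun setT (h n).
    by apply/measurable_EFinP; have [] := bmeasB (bJ' n) (bJ n).
  (* Both times lie in [0, tlim], so the integrals of [f] differ by at most [C * tlim] and the
     terminal rewards by at most [2 * D]. *)
  pose G w := (C%:E * tlim w + (2 * D)%:E)%E.
  have iG : (P x).-integrable setT G.
    apply: integrableD => //; first exact: integrableZl.
    by apply/finite_measure_integrable_cst.
  (* [N'] collects the paths with infinite limit time, a null event since the mean is finite. *)
  have [N' [mN' PN' hN']] := integrable_ae measurableT it.
  have ae (Q : Omega -> Prop) :
      (forall w (t : R), ~ N w -> ~ exc w -> tlim w = t%:E -> Q w) -> {ae P x, forall w, Q w}.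
    move=> hQ; exists (N `|` exc `|` N'); split.
    - by apply: measurableU => //; apply: measurableU => //; exact: (exceptional_meas nice mk fel cf cg).
    - apply: (etrans (measureU0 _ mN' PN')).
        by apply: measurableU => //; exact: (exceptional_meas nice mk fel cf cg).
      by apply: (etrans (measureU0 mN (exceptional_meas nice mk fel cf cg) (exceptional_null nice mk fel cf cg x))).
    - move=> w /= nQ; apply: contrapT => nU; apply: nQ.
      have tfin : tlim w \is a fin_num.
        by apply: contrapT => nf; apply: nU; right; apply: hN' => /= /(_ I).
      by apply: (hQ w (fine (tlim w))); rewrite ?fineK// => hw; apply: nU; left; [left|right].
  have conv w t : ~ N w -> ~ exc w -> tlim w = t%:E ->
      [/\ (fun n => r n w) @ \oo --> t /\ (fun n => X (r n w) w) @ \oo --> X t w,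
          (fun n => r' n w) @ \oo --> t /\ (fun n => X (r' n w) w) @ \oo --> X t w,
          forall n, r n w <= t & forall n, r' n w <= t].
    move=> nN nb tE.
    have cX : (fun n => X (rho n w) w) @ \oo --> X t w.
      by have := hN w nN; rewrite tE; apply; rewrite ltry.
    have sE := star_eq nice mk fel cf cg nb.
    have rt n : r n w <= t by rewrite -lee_fin sminE ?ti.1// tE ge_min lexx.
    have r't n : r' n w <= t by rewrite -lee_fin sminE ?st.1// sE tE ge_min lexx.
    have lr n : rho n w <= r n w.
      rewrite -lee_fin (sminE (s n) (ti.1 w)) le_min capped_hit_le_tinf lee_fin.
      by case: (hs n) => _ _ ->.
    have lr' n : rho n w <= r' n w.
      rewrite -lee_fin (sminE (fun=> n%:R) (st.1 w)) le_min sE capped_hit_le_tinf lee_fin.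
      by apply: smin_le; exact: hit_ge0.
    by split => //; exact: sample_cvg.
  have cvh : {ae P x, forall w, setT w -> h ^~ w @ \oo --> cst 0%E w}.
    apply: ae => w t nN nb tE _; have [[c1 c2] [c3 c4] _ _] := conv w t nN nb tE.
    apply: cvg_EFin; first exact: nearW.
    have cI u : (forall n, 0 <= u n) -> u @ \oo --> t -> (fun n => I_ (u n) w) @ \oo --> I_ t w.
      move=> u0 ut; apply: (@timeint_cvg _ (fun s => f (X s w)) C) => //.
        by move=> v v0; exact: (fpath_rc mk).
      by rewrite -lee_fin -tE; exact: ti.1.
    rewrite -[X in _ --> X](subrr (I_ t w + g (X t w))); apply: cvgB; apply: cvgD.
    + by apply: cI => // n; exact: (rst_r' n).1.
    + exact: continuous_cvg (cg' _) c4.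
    + by apply: cI => // n; exact: (rst_r n).1.
    + exact: continuous_cvg (cg' _) c2.
  have bdh : {ae P x, forall w n, setT w -> (`|h n w| <= G w)%E}.
    apply: ae => w t nN nb tE n _; have [_ _ rt r't] := conv w t nN nb tE.
    rewrite /h /G tE -EFinM -EFinD lee_fin.
    have := Ipath_dist mk cf w hC ((rst_r' n).1 w) ((rst_r n).1 w).
    have : `|r' n w - r n w| <= t.
      have := rt n; have := r't n; have := (rst_r' n).1 w; have := (rst_r n).1 w.
      by move=> *; rewrite ler_norml; apply/andP; split; lra.
    move=> /(ler_wpM2l C0) h1 h2; have h3 := le_trans h2 h1.
    have -> : J' n w - J n w = (I_ (r' n w) w - I_ (r n w) w) + (g (X (r' n w) w) - g (X (r n w) w)).
      by rewrite /J' /J; ring.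
    apply: le_trans (ler_normD _ _) _; apply: lerD => //.
    apply: le_trans (ler_normB _ _) _; rewrite mulrDl mul1r; exact: lerD.
  have [_ _] := dominated_convergence measurableT mh (measurable_cst _) cvh iG bdh.
  rewrite integral0 => /fine_cvg; apply: cvg_trans; apply: near_eq_cvg; exact: nearW.
have ug_le m : ((ug m x)%:E <= lim_payoff P X f g x tstar)%E.
  apply/lee_addgt0Pr => e e0; rewrite -leeBlDr// -EFinB.
  have /cvgrPdist_lt/(_ e e0)[k _ hk] := dctc.
  apply: limf_esup_ge => T; pose n := maxn (maxn m k) (Num.truncn T).+1.
  exists n%:R.
    by apply: ltW; apply: lt_le_trans (truncnS_gt T) _; rewrite ler_nat leq_maxr.
  rewrite (payoffE mk cf cg x st (ler0n _ n)) lee_fin.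
  have kn : (k <= n)%N by rewrite /n !leq_max leqnn orbT.
  have mn : (m <= 2 * n)%N.
    by apply: (@leq_trans n); [rewrite /n !leq_max leqnn|rewrite leq_pmull].
  have := hk n kn; rewrite /= sub0r normrN (expectB P x (bJ' n) (bJ n)) ltr_norml => /andP[h1 _].
  have h2 := optJ n; have h3 := ugrid_le nice mk fel cf cg x mn.
  rewrite -/(r' n) -/(J' n) lerBlDr; apply: le_trans h3 (le_trans h2 _).
  by rewrite -lerBlDl; apply: ltW; rewrite -ltrN2 opprB.
case L : (lim_payoff P X f g x tstar) => [c||]; first 2 last.
- by have := ug_le 0%N; rewrite L.
- by apply: (value_le nice mk fel cf cg) => n; rewrite -lee_fin -L.
- exact: leey.
Qed.

End Optimality.

(** * Finite constants and conclusion *)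

Lemma bounded_cb {R : realType} {E : pmetricType R} (phi : E -> R) :
  continuous phi -> bounded_fun phi -> cb phi.
Proof.
move=> cphi [M [_ hM]]; split => //; exists (M + 1) => y.
by apply: hM => //; rewrite ltrDl.
Qed.

Lemma supnorm_fin {R : realType} {E : pmetricType R} (phi : E -> R) : cb phi ->
  exists2 K : R, supnorm phi = K%:E & forall y, `|phi y| <= K.
Proof.
move=> [_ [C hC]].
have le_sup y : (`|phi y|%:E <= supnorm phi)%E by apply: ereal_sup_ubound; exists y.
have supC : (supnorm phi <= C%:E)%E by apply: ge_ereal_sup => _ [y _ <-]; rewrite lee_fin.
case S : (supnorm phi) le_sup supC => [K||] // le_sup supC.
  by exists K => // y; rewrite -lee_fin.
(* The distinguished point of [E] rules out a supremum equal to -oo. *)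
by have := le_sup point.
Qed.

Theorem theorem2p12 (R : realType) (E : pmetricType R)
  (dO : measure_display) (Omega : measurableType dO)
  (P : E -> probability Omega R) (X : R -> Omega -> E)
  (F : R -> set (set Omega)) (f g : E -> R) (d : E -> R) :
  nice_space E ->
  standard_markov P X F ->
  weak_feller P X ->
  ergodic P X ->
  continuous f -> bounded_fun f ->
  continuous g -> bounded_fun g ->
  (* (B1) *)
  (forall x, d x < 0 /\ (gamma_fun P X F f d x < +oo)%E) ->
  let w := value P X F f g in
  let tstar := tau_star X g w in
  stopping_time F tstar /\
  (forall x : E, lim_payoff P X f g x tstar = w x) /\
  (forall x : E,
     (\int[P x]_om tstar om <=
      (gamma_fun P X F f d x + 2%:E * supnorm g + 1%:E) * ((- d x)^-1)%:E)%E).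
Proof.
move=> nice mk fel _ cf0 bf cg0 bg B1 w tstar.
have cf := bounded_cb cf0 bf; have cg := bounded_cb cg0 bg.
have st : stopping_time F tstar := star_stopping nice mk fel cf cg.
have [K supK gK] := supnorm_fin cg.
have bound x : exists2 c : R, gamma_fun P X F f d x = c%:E &
    (\int[P x]_om tinf P X f g om <= ((c + 2 * K) / (- d x))%:E)%E.
  have [dx gx] := B1 x.
  (* Stopping at time 0 bounds [gamma_fun] below, so with (B1) it is a real number. *)
  have := gamma_lower d mk cf x (rst_cst mk (lexx 0)) (fun=> lexx 0).
  case G : (gamma_fun P X F f d x) gx => [c||] // _ _.
  exists c => //; apply: (mean_tinf nice mk fel cf cg) => n.
  have [s hs] := late_optimal nice mk fel cf cg.
  have [rs sN rle es] := hs n.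
  have rr_r := capped_hit_rst nice mk fel cf cg n.
  have bs r : rst F r -> (forall om, r om <= (2 * n)%N%:R) -> bmeas setT r.
    move=> hr rN; split; first exact: (rst_meas mk hr).
    by exists (2 * n)%N%:R => om _; rewrite ger0_norm ?hr.1.
  apply: (@le_trans _ _ (expect P x (s n))).
    apply: expect_le => //; apply: bs => // om; exact: le_trans (rle om) (sN om).
  apply: (mean_bound mk cf cg rs sN G dx gK).
  (* The mean payoff of [s n] is a grid value, hence at least [g x], as [mean_bound] requires. *)
  by rewrite es; exact: dv_ge_g.
split => //; split => x; have [c Gc Mc] := bound x.
  apply/eqP; rewrite eq_le (value_le_lim_payoff nice mk fel cf cg Mc) andbT.
  by apply: ereal_sup_ubound; exists tstar.
have -> : (\int[P x]_om tstar om = \int[P x]_om tinf P X f g om)%E.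
  apply: ae_eq_integral => //; first exact: (stopping_meas mk st).
    exact: (stopping_meas mk (tinf_stopping nice mk fel cf cg)).
  exists (exceptional P X f g); split.
  - exact: (exceptional_meas nice mk fel cf cg).
  - exact: (exceptional_null nice mk fel cf cg).
  - move=> om /= ne; apply: contrapT => nb; apply: ne => _.
    exact: (star_eq nice mk fel cf cg nb).
have -> : ((gamma_fun P X F f d x + 2%:E * supnorm g + 1%:E) * ((- d x)^-1)%:E =
    ((c + 2 * K + 1) / (- d x))%:E)%E by rewrite Gc supK.
(* The bound obtained is smaller than M(x) by 1/(-d(x)). *)
apply: le_trans Mc _; rewrite lee_fin.
by rewrite ler_pM2r ?lerDl// invr_gt0 oppr_gt0; case: (B1 x).
Qed.
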